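(* Let $\mathcal P=(P_i)_{i=1}^\infty$ be a random split vector, i.e. a random vector with $P_i\ge 0$ and $\sum_i P_i=1$, and let $(T_n^{\mathcal P})_{n\ge1}$ be the corresponding sequence of random split trees, constructed using independent copies $\mathcal P^{(v)}$ of $\mathcal P$ at the nodes $v$ of $\mathcal T_\infty$. Let $Y_n:=Y(T_n^{\mathcal P})$, where $Y(T):=\sum_{v\ne w}h(v\wedge w)$. Assume that with positive probability, $0<P_i<1$ for some $i$. Then there exists a random variable $Q$ such that $Y_n/n^2\to Q$ almost surely as $n\to\infty$. Furthermore, $Q$ has the representation $$Q=\sum_{m=1}^\infty\ \sum_{i_1,\dots,i_m\in\mathbb N}\Bigl(\prod_{j=1}^m P_{i_j}^{(i_1\cdots i_{j-1})}\Bigr)^2,$$ and satisfies $$\mathbb E\, Q=\frac{1}{1-\mathbb E\sum_i P_i^2}-1<\infty$$ and the distributional fixed point equation $$Q\overset{\mathrm d}{=}\sum_{i=1}^\infty P_i^2\bigl(1+Q^{(i)}\bigr),$$ with all $Q^{(i)}$ independent of each other and of $(P_i)_{i=1}^\infty$, and with $Q^{(i)}\overset{\mathrm d}{=}Q$. If $W$ is the size-biased splitting variable of $\mathcal P$, then also $$\mathbb E\, Q=\frac{\mathbb E\, W}{1-\mathbb E\, W}.$$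
   Context: **Tree $\mathcal T_\infty$.** The infinite rooted (Ulam–Harris) tree in which every node has children labelled $1,2,3,\dots$; its nodes are the finite strings $i_1\cdots i_m$ of positive integers ($m\ge0$), the root being the empty string, and the children of $i_1\cdots i_m$ being the strings $i_1\cdots i_m i$, $i\ge1$. **Random split tree.** Give each node $v$ of $\mathcal T_\infty$ an independent copy $\mathcal P^{(v)}=(P^{(v)}_i)_i$ of the split vector $\mathcal P$, chosen once and kept fixed. Each node holds at most one ball and is full if it holds one; initially all nodes are empty. Balls arrive one by one at the root and move instantaneously: (i) a ball arriving at an empty node stays there, making it full; (ii) a ball arriving at a full node $v$ continues to a child of $v$, child $i$ being chosen with probability $P_i^{(v)}$; given all vectors $\mathcal P^{(v)}$, all these choices are independent. $T_n^{\mathcal P}$ is the subtree of $\mathcal T_\infty$ consisting of the nodes that contain the first $n$ balls; all $T_n^{\mathcal P}$, $n\ge1$, are constructed from the same stream of balls. (A finite split vector $(P_i)_{i=1}^b$, $b\ge2$, is included by setting $P_i=0$ for $i>b$.) **The parameter $Y$.** For a rooted tree $T$, $h(v)$ is the depth of node $v$, i.e. its distance to the root, and $v\wedge w$ is the last (deepest) common ancestor of $v$ and $w$ (a node counts as an ancestor of itself here). $Y(T)=\sum_{v\ne w}h(v\wedge w)$, the sum being over all ordered pairs of distinct nodes of $T$. **Size-biased variable $W$.** Sample $\mathcal P=(P_i)_i$; given $\mathcal P$, sample $I\in\mathbb N$ with $\mathbb P(I=i\mid\mathcal P)=P_i$; then $W:=P_I$. *)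

(* Defs.v *)
From HB Require Import structures.
From mathcomp Require Import all_boot all_order all_algebra finmap.
From mathcomp Require Import all_classical all_reals all_analysis measurable_realfun.


Import Order.TTheory GRing.Theory Num.Theory.
Import numFieldNormedType.Exports.

Local Open Scope classical_set_scope.
Local Open Scope ring_scope.

(* Nodes of the Ulam-Harris tree: finite strings, the root being [::].
   Labels are shifted by one: the child labelled i >= 1 of v is rcons v i.-1. *)
Definition node := seq nat.

Definition depth (v : node) : nat := size v.

(* The ancestors of v, itself included, are the prefixes of v. *)
Fixpoint lca (v w : node) : node :=
  match v, w with
  | i :: v', j :: w' => if i == j then i :: lca v' w' else [::]
  | _, _ => [::]
  end.

Lemma prefix_lca (u v w : node) :
  prefix u (lca v w) = prefix u v && prefix u w.
Proof.
elim: u v w => [|k u IH] [|i v] [|j w]; rewrite ?prefix0s ?prefixs0 ?andbF //=.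
case: (eqVneq i j) => [<-|neq_ij] /=.
  by rewrite IH; case: (k == i).
by case: (eqVneq k i) => [->|] //=; rewrite (negbTE neq_ij) /= andbF.
Qed.

Definition Y (S : {fset node}) : nat :=
  (\sum_(v <- S) \sum_(w <- S | v != w) depth (lca v w))%N.

(* A ball at v, with choice function c (v is left for its child c v) and set S
   of full nodes, moves on at most k times.  From the root, k = #|` S| moves
   always suffice to reach an empty node, see descend_notin. *)
Fixpoint descend (S : {fset node}) (c : node -> nat) (k : nat) (v : node) :
    node :=
  if k is k'.+1 then
    if v \in S then descend S c k' (rcons v (c v)) else v
  else v.

Lemma descend_notin (S : {fset node}) (c : node -> nat) :
  descend S c #|` S| [::] \notin S.
Proof.
suff H k (U : {fset node}) v : (U `<=` S)%fset ->
    (forall u, u \in U -> (size u < size v)%N) -> (#|` S| <= #|` U| + k)%N ->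
    descend S c k v \notin S.
  by apply: (H _ fset0) => //; rewrite ?fsub0set ?cardfs0.
elim: k U v => [|k IH] U v US Uv /= card_le.
  have <- : U = S by apply/eqP; rewrite eqEfcard US -[#|` U|]addn0.
  by apply/negP => /Uv; rewrite ltnn.
case: ifPn => // vS; apply: (IH (v |` U)%fset).
- by rewrite fsubUset fsub1set vS.
- by move=> u; rewrite size_rcons !inE => /orP[/eqP->//|/Uv/leqW].
- by rewrite cardfsU1 (_ : v \notin U) ?addSnnS //; apply/negP => /Uv;
    rewrite ltnn.
Qed.

(* Balls are numbered from 0; C k v is the child chosen by ball k if it finds
   the node v full. *)
Fixpoint split_tree (C : nat -> node -> nat) (n : nat) : {fset node} :=
  if n is n'.+1 then
    let S := split_tree C n' in (descend S (C n') #|` S| [::] |` S)%fset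
  else fset0.

Section Probability.
Context {R : realType}.

Definition sigma_rv {I T : Type} {d'} {T' : measurableType d'}
    (X : I -> T -> T') : set (set T) :=
  <<s \bigcup_i preimage_set_system setT (X i) measurable >>.

(* The product sigma-algebra of R^I. *)
Definition product_measurable {I : Type} : set (set (I -> R)) :=
  sigma_rv (fun i (x : I -> R) => x i).

Definition same_law {d1 d2 d'} {T1 : measurableType d1}
    {T2 : measurableType d2} {T' : measurableType d'}
    (P1 : probability T1 R) (X1 : T1 -> T')
    (P2 : probability T2 R) (X2 : T2 -> T') : Prop :=
  forall B, measurable B -> P1 (X1 @^-1` B) = P2 (X2 @^-1` B).

Definition same_joint_law {d1 d2} {T1 : measurableType d1}
    {T2 : measurableType d2} {I : Type}
    (P1 : probability T1 R) (X1 : I -> T1 -> R)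
    (P2 : probability T2 R) (X2 : I -> T2 -> R) : Prop :=
  forall A, product_measurable A ->
    P1 [set t | A (X1^~ t)] = P2 [set t | A (X2^~ t)].

Definition independent {d} {T : measurableType d} (P : probability T R)
    {I : choiceType} (F : I -> set (set T)) : Prop :=
  forall (J : {fset I}) (E : I -> set T), (forall i, i \in J -> F i (E i)) ->
    P (\bigcap_(i in [set` J]) E i) = (\prod_(i <- J) P (E i))%E.

Definition split_vector {d} {T : measurableType d} (P : probability T R)
    (p : nat -> {RV P >-> R}) : Prop :=
  {ae P, forall t, (forall i, 0 <= p i t) /\
                   (\sum_(i <oo) (p i t)%:E = 1)%E}.

Definition iid_copies {d0 d} {T0 : measurableType d0} {T : measurableType d}
    (P0 : probability T0 R) (p : nat -> {RV P0 >-> R})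
    (P : probability T R) (V : node -> nat -> {RV P >-> R}) : Prop :=
  (forall v, same_joint_law P (V v) P0 p) /\
  independent P (fun v => sigma_rv (V v)).

(* Given all the vectors V v, the choices C k v are independent, and C k v = i
   with probability V v i: the conditional probability of
   {C k v = c (k, v) for all (k, v) in F} is the product of the V v (c (k, v)),
   expressed by integration over the events A of the sigma-algebra generated
   by all the vectors. *)
Definition choices_given {d} {T : measurableType d} (P : probability T R)
    (V : node -> nat -> {RV P >-> R}) (C : nat -> node -> {RV P >-> nat}) :
    Prop :=
  forall (F : {fset nat * node}) (c : nat * node -> nat) (A : set T),
    sigma_rv (fun vi : node * nat => V vi.1 vi.2 : T -> R) A ->
    P (A `&` \bigcap_(x in [set` F]) [set t | C x.1 x.2 t = c x]) =
    (\int[P]_(t in A) (\prod_(x <- F) V x.2 (c x) t)%:E)%E.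

(* I has conditional law (p_i)_i given the vector p. *)
Definition index_given {d} {T : measurableType d} (P : probability T R)
    (p : nat -> {RV P >-> R}) (I : {RV P >-> nat}) : Prop :=
  forall (i : nat) (A : set T), sigma_rv (fun j => p j : T -> R) A ->
    P (A `&` [set t | I t = i]) = (\int[P]_(t in A) (p i t)%:E)%E.

(* sum_{m >= 1} sum_{i_1, ..., i_m}
     (prod_{1 <= j <= m} V^{(i_1 ... i_{j-1})}_{i_j})^2 *)
Definition Q_series {T : Type} (V : node -> nat -> T -> R) (t : T) : \bar R :=
  (\sum_(1 <= m <oo) \esum_(s in [set: m.-tuple nat])
     ((\prod_(j < m) V (take j s) (tnth s j) t) ^+ 2)%:E)%E.

(* On the probability space P', p' is a copy of the vector p, the Q' i are
   copies of Q, and p', Q' 0, Q' 1, ... are independent. *)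
Definition fixed_point_input {d0 d d'} {T0 : measurableType d0}
    {T : measurableType d} {T' : measurableType d'}
    (P0 : probability T0 R) (p : nat -> {RV P0 >-> R})
    (P : probability T R) (Q : {RV P >-> R})
    (P' : probability T' R) (p' Q' : nat -> {RV P' >-> R}) : Prop :=
  [/\ same_joint_law P' p' P0 p,
      forall i, same_law P' (Q' i) P Q &
      independent P' (fun o : option nat =>
        if o is Some i then preimage_set_system setT (Q' i) measurable
        else sigma_rv p')].

End Probability.

(* Main.v *)
From HB Require Import structures.
Require Import Defs.
From mathcomp Require Import all_boot all_order all_algebra finmap.
From mathcomp Require Import all_classical all_reals all_analysis measurable_realfun.
From mathcomp Require Import zify ring lra.
Import Order.TTheory GRing.Theory Num.Theory.
Import numFieldNormedType.Exports.
Local Open Scope classical_set_scope.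
Local Open Scope ring_scope.

(** Let every ball k go on along an infinite path ("ray"), whether or not it
    meets an empty node; given the vectors, the rays are i.i.d. and pass through
    a node u with probability w(u), the product of the P's on the way to u.
    The ball k stops at a vertex of its ray, and summing over the levels m >= 1
    the indicators that the common ancestor has depth at least m shows that Y_n
    is, up to 2mn at level m, the number Z(m, n) of ordered pairs of distinct
    balls k, l < n whose rays agree up to level m.

    Z(m, n) is a U-statistic.  With q_m = sum_(|u| = m) w(u)^2 and
    a = E sum_i P_i^2 < 1, the events "rays k and l agree up to level m" have
    probability E q_m = a^m, and for distinct k, l, k', l' the correlations of
    two of them, and of one of them with q_m, are E q_m^2.  Hence
    E (Z(m, n) - n(n-1) q_m)^2 <= 4 n^3 a^m, which is summable over m and over
    n = j^4 even after multiplication by b^-m j^2, for a < b < 1.  So almost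
    surely Z(m, n)/n^2 - q_m is O(q_m + b^(m/2)) times a null sequence,
    uniformly in m, along n = j^4 and, Z being monotone in n, along all n.
    Summing over m gives Y_n/n^2 -> Q = sum_(m >= 1) q_m.

    The fixed point equation is the decomposition of Q at the root; subtrees are
    independent of each other and of the root vector by a pi-lambda argument,
    and the same argument shows that the law of the right-hand side only depends
    on the marginal laws. *)

(** * Product sigma-algebras as measurable spaces *)

Section env.
Context {R : realType}.

Definition coord_system (I : Type) : set (set (I -> R)) :=
  \bigcup_i preimage_set_system setT (fun x : I -> R => x i) measurable.

(** With this type the [product_measurable] sets become [measurable], so a whole family of variables
    is one random element with values in [env I]. *)
Definition env (I : Type) := g_sigma_algebraType (coord_system I).

Lemma measurable_coord (I : Type) (i : I) :
  measurable_fun setT (fun x : env I => x i).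
Proof.
by move=> _ B mB; apply: sub_sigma_algebra; exists i => //; exists B.
Qed.

Lemma measurable_env d (T : measurableType d) (I : Type) (f : T -> env I) :
  (forall i, measurable_fun setT (fun t => f t i)) -> measurable_fun setT f.
Proof.
move=> mf; apply: (@measurability _ _ T (env I) setT f (coord_system I) erefl).
by move=> _ [_ [i _ [B mB <-]] <-]; rewrite !setTI; have := mf i measurableT B mB; rewrite setTI.
Qed.

(** Good-sets argument: the sets [B] with this property form a sigma-algebra containing the
    one-coordinate cylinders. *)
Lemma sigma_rv_preimage (I T : Type) (X : I -> T -> R) (B : set (env I)) :
  measurable B -> sigma_rv X [set t | B (X^~ t)].
Proof.
pose G : set (set (I -> R)) := [set B | sigma_rv X [set t | B (X^~ t)]].
suff : <<s coord_system I >> `<=` G by move=> h /h.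
apply: smallest_sub.
  split.
  - exact: sigma_algebra0.
  - move=> A GA; rewrite /G /=.
    have : sigma_rv X (setT `\` [set t | A (X^~ t)]) by exact: sigma_algebraCD.
    by congr (sigma_rv X _); apply/seteqP; split.
  - move=> F GF; rewrite /G/=.
    have : sigma_rv X (\bigcup_n [set t | F n (X^~ t)]).
      by apply: sigma_algebra_bigcup => n; exact: GF.
    by congr (sigma_rv X _); apply/seteqP; split => t [n _ ?]; exists n.
move=> _ [i _ [A mA <-]]; apply: sub_sigma_algebra.
by exists i => //; exists A => //; rewrite !setTI.
Qed.

End env.

(** * Integrals against functions of a random element *)

Section integral_factor.
Local Open Scope ereal_scope.
Context {R : realType} {d d'} {T : measurableType d} {E : measurableType d'}.
Variables (P : {measure set T -> \bar R}) (phi : T -> E).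
Hypothesis mphi : measurable_fun setT phi.

Let mpre B : measurable B -> measurable (phi @^-1` B).
Proof. by move=> mB; rewrite -[X in measurable X]setTI; exact: mphi. Qed.

Import HBNNSimple.

(** Monotone convergence along simple functions below [F]. The right-hand side sees [u] only through
    its integrals over preimages under [phi]. *)
Let integral_factor_approx (u : T -> R) (F : E -> \bar R)
    (mF : measurable_fun setT F) :
  (forall t, 0 <= u t)%R -> measurable_fun setT u -> (forall x, 0 <= F x) ->
  \int[P]_t (F (phi t) * (u t)%:E) =
  limn (fun n => let f := nnsfun_approx measurableT mF n in
   \sum_(r \in range f)
    r%:E * \int[P]_(t in phi @^-1` (f @^-1` [set r])) (u t)%:E).
Proof.
move=> u0 mu F0.
pose f_ := nnsfun_approx measurableT mF.
transitivity (limn (fun n => \int[P]_t ((f_ n (phi t))%:E * (u t)%:E))).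
  rewrite -monotone_convergence//.
  - apply: eq_integral => t _; apply/esym/cvg_lim => //.
    apply: cvgeZr => //.
    by apply: cvg_nnsfun_approx=> // *; apply: F0.
  - move=> n; apply: emeasurable_funM => //; last exact/measurable_EFinP.
    by apply/measurable_EFinP; exact: measurableT_comp.
  - by move=> n t _; rewrite mule_ge0 ?lee_fin.
  - move=> t _ m n mn; rewrite lee_wpmul2r ?lee_fin//; exact/lefP/nd_nnsfun_approx.
congr (lim (_ @ \oo)); apply/funext => n /=.
transitivity (\int[P]_t \sum_(r \in range (f_ n))
    (r%:E * (u t * \1_(phi @^-1` (f_ n @^-1` [set r])) t)%:E)).
  apply: eq_integral => t _.
  rewrite fimfunE -EFinM mulr_fsuml.
  rewrite -fsumEFin//; apply: eq_fsbigr => r _.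
  by rewrite EFinM -!EFinM mulrAC mulrA.
rewrite ge0_integral_fsum//.
- apply: eq_fsbigr => r /[!inE] -[x _ <-].
  have mB : measurable (phi @^-1` (f_ n @^-1` [set f_ n x])).
    exact/mpre/measurable_funPTI.
  rewrite ge0_integralZl//.
  + rewrite [in RHS]integral_mkcond; congr (_ * _); apply: eq_integral => t _.
    by rewrite /patch indicE; case: ifPn; rewrite ?mulr1 ?mulr0.
  + apply/measurable_EFinP; apply: measurable_funM => //; exact: measurable_indic.
  + by move=> t _; rewrite lee_fin mulr_ge0.
  + by rewrite lee_fin.
- move=> r; apply: emeasurable_funM => //; apply/measurable_EFinP.
  apply: measurable_funM => //; apply: measurable_indic.
  exact/mpre/measurable_funPTI.
- move=> r t _; rewrite -EFinM lee_fin.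
  (* An [r] outside the range may be negative, but then its level set is empty and the indicator
     vanishes. *)
  have [[x _ <-]|] := pselect (range (f_ n) r).
    by rewrite mulr_ge0// mulr_ge0.
  move=> nr; rewrite indicE memNset ?mulr0// => rt; apply: nr; by exists (phi t).
Qed.

(** The hypothesis says that [u] and [v] have the same conditional expectation given [phi]. In this
    form conditioning on the split vectors is carried out in what follows. *)
Lemma ge0_integral_factor (u v : T -> R) (F : E -> \bar R) :
  (forall t, 0 <= u t)%R -> measurable_fun setT u ->
  (forall t, 0 <= v t)%R -> measurable_fun setT v ->
  (forall B, measurable B ->
    \int[P]_(t in phi @^-1` B) (u t)%:E = \int[P]_(t in phi @^-1` B) (v t)%:E) ->
  (forall x, 0 <= F x) -> measurable_fun setT F ->
  \int[P]_t (F (phi t) * (u t)%:E) = \int[P]_t (F (phi t) * (v t)%:E).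
Proof.
move=> u0 mu v0 mv uv F0 mF; rewrite !(integral_factor_approx _ _ mF)//.
congr (lim (_ @ \oo)); apply/funext => n /=; apply: eq_fsbigr => r _.
congr (_ * _); apply: uv; exact: measurable_funPTI.
Qed.

End integral_factor.

(** * Independence and joint laws *)

Section measure_eq.
Local Open Scope ereal_scope.
Context {R : realType} {d} {T : measurableType d}.

Lemma measure_eq_pi_system (G : set (set T)) (m1 m2 : {measure set T -> \bar R}) :
  G `<=` measurable -> setI_closed G -> G setT ->
  (forall A, G A -> m1 A = m2 A) -> m1 setT < +oo ->
  forall A, <<s G >> A -> m1 A = m2 A.
Proof.
move=> Gm GI GT m12 m1T; apply: (g_sigma_algebra_measure_unique G Gm (fun=> setT)) => //.
by apply/seteqP; split => // x _; exists 0%N.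
Qed.

End measure_eq.

Section finI_system.
Context {I : choiceType} {T : Type}.

(** The pi-system of cylinder events: finite intersections with one set from each of finitely many
    [F i]. *)
Definition finI_system (F : I -> set (set T)) : set (set T) :=
  [set A | exists (J : {fset I}) (E : I -> set T),
    (forall i, i \in J -> F i (E i)) /\ A = \bigcap_(i in [set` J]) E i].

Lemma finI_systemT F : finI_system F setT.
Proof.
exists fset0, (fun=> setT); split; first by move=> i; rewrite inE.
by rewrite set_fset0 bigcap_set0.
Qed.

Lemma sub_finI_system F i : F i `<=` finI_system F.
Proof.
move=> A FA; exists [fset i]%fset, (fun=> A); split.
  by move=> j; rewrite inE => /eqP ->.
by rewrite set_fset1 bigcap_set1.
Qed.

Lemma finI_systemI F : (forall i, setI_closed (F i)) ->
  setI_closed (finI_system F).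
Proof.
move=> FI A A' [J [E [FE ->]]] [J' [E' [FE' ->]]].
(* Padding with [setT] brings both intersections to the common index set. *)
exists (J `|` J')%fset, (fun i => (if i \in J then E i else setT) `&`
   (if i \in J' then E' i else setT)); split.
  move=> i; rewrite inE; case: ifPn => iJ /=; case: ifPn => iJ' //= _.
  - by apply: FI; [exact: FE|exact: FE'].
  - by rewrite setIT; exact: FE.
  - by rewrite setTI; exact: FE'.
apply/seteqP; split => t.
  by move=> [h h'] i /= _; split; case: ifPn => // ?; [exact: h|exact: h'].
move=> h; split => i /= iJ.
  by have := h i; rewrite /= inE iJ => /(_ isT)[].
by have := h i; rewrite /= inE iJ orbT => /(_ isT)[].
Qed.

Lemma sub_finI_system_setI_closed F (G : set (set T)) :
  G setT -> setI_closed G -> (forall i, F i `<=` G) -> finI_system F `<=` G.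
Proof.
move=> GT GI FG _ [J [E [FE ->]]].
rewrite bigcap_fset big_seq; elim/big_ind: _ => // i /FE; exact: FG.
Qed.

End finI_system.

Section independence.
Local Open Scope ereal_scope.
Context {R : realType} {d} {T : measurableType d} (P : probability T R).

(** The pi-systems are replaced by their sigma-algebras one index at a time: with the other sets
    fixed, both sides of the product formula are finite measures in the remaining set, equal on its
    pi-system. *)
Lemma independent_g_sigma (K : choiceType) (G : K -> set (set T)) :
  (forall k, G k `<=` measurable) -> (forall k, setI_closed (G k)) ->
  (forall k, G k setT) -> independent P G -> independent P (fun k => <<s G k >>).
Proof.
move=> Gm GI GT indG.
have sGm k : <<s G k >> `<=` measurable.
  apply: smallest_sub => //; exact: sigma_algebra_measurable.
(* Indices in [s] already carry sets of the generated sigma-algebra, those in [s'] only sets of the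
   pi-system. *)
have claim (s s' : seq K) (E : K -> set T) : uniq (s ++ s') ->
    (forall k, k \in s -> <<s G k >> (E k)) ->
    (forall k, k \in s' -> G k (E k)) ->
    P (\big[setI/setT]_(k <- s ++ s') E k) = \prod_(k <- s ++ s') P (E k).
  elim: s s' E => [|k s IH] s' E.
    move=> us' _ GE; have := indG [fset k in s']%fset E.
    have pm : perm_eq [fset k in s']%fset s'.
      by apply: uniq_perm => // k; rewrite inE.
    rewrite bigcap_fset !(perm_big _ pm) => -> // k; rewrite inE; exact: GE.
  rewrite cat_cons cons_uniq => /andP[ks us] sE GE.
  rewrite !big_cons.
  set B := \big[setI/setT]_(i <- s ++ s') E i.
  have mB : measurable B.
    rewrite /B big_seq; elim/big_ind: _ => // [A A' ? ?|i].
      exact: measurableI.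
    by rewrite mem_cat => /orP[i1|/GE/Gm//]; apply: (sGm i); apply: sE; rewrite inE i1 orbT.
  have PB : P B = \prod_(i <- s ++ s') P (E i).
    by apply: IH => // i is_; apply: sE; rewrite inE is_ orbT.
  rewrite -PB.
  have PBfin : P B \is a fin_num by exact: fin_num_measure.
  have fPB : (0 <= fine (P B))%R by exact: fine_ge0.
  rewrite muleC -[X in X * _]fineK//.
  (* [m1 A] is [P (A & B)] and [m2 A] is [P B * P A]; on [G k] they agree by the induction
     hypothesis with [k] moved into [s']. *)
  pose m1 : {measure set T -> \bar R} := mrestr P mB.
  pose m2 : {measure set T -> \bar R} := mscale (NngNum fPB) P.
  suff /(_ (E k)) : forall A, <<s G k >> A -> m1 A = m2 A.
    by apply; apply: sE; rewrite mem_head.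
  apply: (@measure_eq_pi_system _ _ _ (G k)) => //.
  - move=> A GA; change (P (A `&` B) = (fine (P B))%:E * P A).
    rewrite fineK// PB.
    pose E' i := if i == k then A else E i.
    have E'E i : i \in s ++ s' -> E' i = E i.
      by rewrite /E'; case: eqP => // ->; rewrite (negbTE ks).
    have E'k : E' k = A by rewrite /E' eqxx.
    have := IH (k :: s') E'.
    have pm : perm_eq (s ++ k :: s') (k :: (s ++ s')) by rewrite perm_catC /= perm_cons perm_catC.
    rewrite (perm_uniq pm) cons_uniq ks us => /(_ isT).
    rewrite !(perm_big _ pm)/= !big_cons E'k.
    rewrite (eq_big_seq _ E'E) (@eq_big_seq _ _ _ _ _ _ (fun i => P (E i))); last first.
      by move=> i /E'E ->.
    rewrite muleC => ->//.
    + move=> i is_; rewrite E'E ?mem_cat ?is_//; apply: sE; by rewrite inE is_ orbT.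
    + move=> i; rewrite inE => /orP[/eqP->|is_]; first by rewrite E'k.
      by rewrite E'E ?mem_cat ?is_ ?orbT//; apply: GE.
  - change (P (setT `&` B) < +oo); rewrite setTI.
    exact: (le_lt_trans (probability_le1 P mB)) (ltry _).
move=> J E sE.
have := claim (enum_fset J) [::] E; rewrite cats0 => /(_ (fset_uniq J)) <-//.
by rewrite bigcap_fset.
Qed.

Lemma independent_sub (K : choiceType) (F G : K -> set (set T)) :
  (forall k, F k `<=` G k) -> independent P G -> independent P F.
Proof. by move=> FG indG J E FE; apply: indG => i /FE; exact: FG. Qed.

Lemma independent_pair (K : choiceType) (F : K -> set (set T)) k l A B :
  independent P F -> k != l -> F k A -> F l B -> P (A `&` B) = P A * P B.
Proof.
move=> indF kl FA FB.
have := indF [fset k; l]%fset (fun i => if i == k then A else B).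
rewrite big_fsetU1 ?inE//= big_seq_fset1 eqxx eq_sym (negbTE kl) => <-.
  rewrite bigcap_fset big_fsetU1 ?inE//= big_seq_fset1 eqxx.
  by rewrite [l == k]eq_sym (negbTE kl).
by move=> i; rewrite !inE => /orP[] /eqP ->; rewrite ?eqxx// eq_sym (negbTE kl).
Qed.

(** Each fibre of [pi] has a pi-system of finite intersections generating its sigma-algebra. On
    these pi-systems the product formula is that of [F], regrouped by fibres. *)
Lemma independent_group (I K : choiceType) (pi : I -> K)
    (F : I -> set (set T)) :
  (forall i, F i `<=` measurable) -> (forall i, setI_closed (F i)) ->
  (forall i, F i setT) -> independent P F ->
  independent P (fun k => <<s \bigcup_(i in [set i | pi i = k]) F i >>).
Proof.
move=> Fm FI FT indF.
(* Off the fibre over [k] only the trivial event is allowed, so that [finI_system (Fk k)] is the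
   pi-system of that fibre. *)
pose Fk k i : set (set T) := if pi i == k then F i else [set setT].
have FkI k i : setI_closed (Fk k i).
  by rewrite /Fk; case: ifP => // _ A B /= -> ->; rewrite setTI.
apply: (@independent_sub _ _ (fun k => <<s finI_system (Fk k) >>)).
  move=> k; apply: smallest_sub; first exact: smallest_sigma_algebra.
  move=> A [i /= ik FA]; apply: sub_sigma_algebra; apply: (@sub_finI_system _ _ _ i).
  by rewrite /Fk ik eqxx.
apply: independent_g_sigma => [k|k|k|].
- apply: sub_finI_system_setI_closed => // [A B mA mB|i]; first exact: measurableI.
  by rewrite /Fk; case: ifP => // _ A ->.
- exact: finI_systemI.
- exact: finI_systemT.
move=> J E FE.
have /choice[f fP] : forall k, exists p : {fset I} * (I -> set T), k \in J ->
    (forall i, i \in p.1 -> Fk k i (p.2 i)) /\ E k = \bigcap_(i in [set` p.1]) p.2 i.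
  move=> k; have [kJ|kJ] := boolP (k \in J); last by exists (fset0, fun=> setT).
  by have [J' [E' ?]] := FE k kJ; exists (J', E').
pose g k := [seq i <- (f k).1 | pi i == k].
pose E' i := (f (pi i)).2 i.
have gF k i : k \in J -> i \in g k -> F i (E' i).
  move=> kJ; rewrite mem_filter => /andP[/eqP ik fi]; have [/(_ _ fi) + _] := fP _ kJ.
  by rewrite /Fk ik eqxx /E' ik.
have Eg k : k \in J -> E k = \big[setI/setT]_(i <- g k) E' i.
  move=> kJ; have [Fi ->] := fP _ kJ; rewrite bigcap_fset big_filter.
  rewrite (bigID (fun i => pi i == k)) /= [X in _ `&` X]big_seq_cond [X in _ `&` X]big1 ?setIT.
    by apply: eq_bigr => i /eqP ik; rewrite /E' ik.
  by move=> i /andP[/Fi + ik]; rewrite /Fk (negbTE ik).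
have ug k : uniq (g k) by rewrite filter_uniq// fset_uniq.
have indg s : uniq s -> (forall i, i \in s -> F i (E' i)) ->
    P (\big[setI/setT]_(i <- s) E' i) = \prod_(i <- s) P (E' i).
  move=> us Fs; have := indF [fset i in s]%fset E'.
  have pm : perm_eq [fset i in s]%fset s by apply: uniq_perm => // i; rewrite inE.
  by rewrite bigcap_fset !(perm_big _ pm) => -> // i; rewrite inE; exact: Fs.
pose s := flatten [seq g k | k <- J].
have us : uniq s.
  rewrite /s; elim: (enum_fset J) (fset_uniq J) => //= k r IH /andP[kr ur].
  rewrite cat_uniq ug IH// andbT; apply/hasPn => i /flattenP[_ /mapP[l lr ->]].
  rewrite !mem_filter => /andP[/eqP il _]; apply/negP => /andP[/eqP ik _].
  by move: kr; rewrite -ik il lr.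
have sF i : i \in s -> F i (E' i).
  by move=> /flattenP[_ /mapP[k kJ ->]]; exact: gF.
rewrite bigcap_fset (eq_big_seq _ Eg).
have := indg _ us sF; rewrite !big_flatten/= !big_map => ->.
by apply: eq_big_seq => k kJ; rewrite Eg// indg// => i; exact: gF.
Qed.

End independence.

(** On finite intersections independence factors both laws into marginals, which agree; these
    intersections are a generating pi-system. *)
Lemma eq_law_independent {R : realType} {d1 d2 d'} {T1 : measurableType d1}
    {T2 : measurableType d2} {E : measurableType d'}
    (P1 : probability T1 R) (P2 : probability T2 R)
    (X1 : T1 -> E) (X2 : T2 -> E) (I : choiceType) (F : I -> set (set E)) :
  measurable_fun setT X1 -> measurable_fun setT X2 ->
  @measurable _ E = <<s \bigcup_i F i >> -> (forall i, setI_closed (F i)) ->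
  independent P1 (fun i => preimage_set_system setT X1 (F i)) ->
  independent P2 (fun i => preimage_set_system setT X2 (F i)) ->
  (forall i B, F i B -> P1 (X1 @^-1` B) = P2 (X2 @^-1` B)) ->
  forall B, measurable B -> P1 (X1 @^-1` B) = P2 (X2 @^-1` B).
Proof.
move=> mX1 mX2 mE FI ind1 ind2 P12 B mB.
have Fm i : F i `<=` measurable by rewrite mE => A FA; apply: sub_sigma_algebra; exists i.
pose Y1 : {mfun T1 >-> E} := HB.pack X1 (isMeasurableFun.Build _ _ _ _ X1 mX1).
pose Y2 : {mfun T2 >-> E} := HB.pack X2 (isMeasurableFun.Build _ _ _ _ X2 mX2).
rewrite -[LHS]/(distribution P1 Y1 B) -[RHS]/(distribution P2 Y2 B).
apply: (@measure_eq_pi_system _ _ _ (finI_system F)).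
- apply: sub_finI_system_setI_closed => // ? ? ? ?; exact: measurableI.
- exact: finI_systemI.
- exact: finI_systemT.
- move=> _ [J [D [FD ->]]];
  change (P1 (X1 @^-1` (\bigcap_(i in [set` J]) D i)) =
          P2 (X2 @^-1` (\bigcap_(i in [set` J]) D i))).
  rewrite !preimage_bigcap.
  rewrite ind1; last by move=> i /FD ?; exists (D i); rewrite ?setTI.
  rewrite ind2; last by move=> i /FD ?; exists (D i); rewrite ?setTI.
  by apply: eq_big_seq => i /FD; exact: P12.
- by change (P1 (X1 @^-1` setT) < +oo)%E; rewrite preimage_setT probability_setT ltry.
- move: mB; rewrite mE; apply: smallest_sub; first exact: smallest_sigma_algebra.
  by move=> A [i _ FA]; apply: sub_sigma_algebra; exact: sub_finI_system FA.
Qed.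

(** Given [X2], the variable [f (X1 t)] has the same conditional expectation as the constant [c],
    its mean; [ge0_integral_factor] then replaces one by the other. *)
Lemma independent_integralM {R : realType} {d d1 d2} {T : measurableType d}
    {E1 : measurableType d1} {E2 : measurableType d2}
    (P : probability T R) (X1 : T -> E1) (X2 : T -> E2) (f : E1 -> R) (g : E2 -> \bar R) :
  measurable_fun setT X1 -> measurable_fun setT X2 ->
  (forall A B, measurable A -> measurable B ->
    P (X1 @^-1` A `&` X2 @^-1` B) = P (X1 @^-1` A) * P (X2 @^-1` B))%E ->
  measurable_fun setT f -> (forall x, 0 <= f x) ->
  measurable_fun setT g -> (forall x, 0 <= g x)%E ->
  (\int[P]_t (f (X1 t))%:E < +oo)%E ->
  (\int[P]_t (g (X2 t) * (f (X1 t))%:E) = \int[P]_t (g (X2 t)) * \int[P]_t (f (X1 t))%:E)%E.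
Proof.
move=> mX1 mX2 ind mf f0 mg g0 fi.
have if0 : (0 <= \int[P]_t (f (X1 t))%:E)%E by apply: integral_ge0 => t _; rewrite lee_fin.
set c := (\int[P]_t (f (X1 t))%:E)%E in fi if0 *.
have cE : c = (fine c)%:E by rewrite fineK// ge0_fin_numE.
have mpre d' (E : measurableType d') (X : T -> E) B : measurable_fun setT X ->
  measurable B -> measurable (X @^-1` B).
  by move=> mX mB; rewrite -[X in measurable X]setTI; exact: mX.
transitivity (\int[P]_t (g (X2 t) * (fine c)%:E))%E; last first.
  rewrite ge0_integralZr// -?cE//; exact: measurableT_comp.
apply: (ge0_integral_factor P X2 mX2) => //; first exact: measurableT_comp.
  by move=> t; exact: fine_ge0.
move=> B mB; rewrite integral_cst//; last exact: mpre.
have mXB := mpre _ _ _ _ mX2 mB.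
transitivity (\int[P]_t ((f (X1 t))%:E * (\1_(X2 @^-1` B) t)%:E))%E.
  rewrite integral_mkcond; apply: eq_integral => t _.
  by rewrite /patch indicE; case: ifPn; rewrite ?mule1 ?mule0.
(* The same device with the roles exchanged: given [X1], the indicator of an event of [X2] is
   replaced by its probability. *)
rewrite (ge0_integral_factor P X1 mX1 _ (fun=> fine (P (X2 @^-1` B))) (EFin \o f))//=.
- rewrite ge0_integralZr//.
  + by rewrite -/c -cE fineK// fin_num_measure.
  + by apply/measurable_EFinP; exact: measurableT_comp.
  + by move=> t _; rewrite lee_fin.
  + by rewrite lee_fin fine_ge0.
- by move=> t; exact: fine_ge0.
- move=> A mA; rewrite integral_cst//; last exact: mpre.
  rewrite fineK ?fin_num_measure//= muleC -ind// integral_indic//; last exact: mpre.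
  by rewrite setIC.
- exact/measurable_EFinP.
Qed.

(** * Measurability and integration of series and countable sums *)

Section eseries_measurable.
Local Open Scope ereal_scope.
Context {R : realType} {d} {T : measurableType d}.

Lemma limn_einf_esup_cvg (u : (\bar R)^nat) : limn_einf u = limn_esup u -> cvgn u.
Proof.
move=> ul; have cs : esups u @ \oo --> limn_esup u.
  by rewrite limn_esup_lim; exact: is_cvg_esups.
have ci : einfs u @ \oo --> limn_esup u.
  by rewrite -ul limn_einf_lim; exact: is_cvg_einfs.
apply/cvg_ex; exists (limn_esup u); apply: (squeeze_cvge _ ci cs).
apply: nearW => n; apply/andP; split.
  by apply: ereal_inf_lbound; exists n => /=.
by apply: ereal_sup_ubound; exists n => /=.
Qed.

(** The terms may have any sign, as in [fixed_point_map]. The series converges where the lower and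
    upper limits of its partial sums agree; elsewhere its value is the default [point]. *)
Lemma measurable_eseries (f : nat -> T -> \bar R) :
  (forall n, measurable_fun setT (f n)) ->
  measurable_fun setT (fun t => \sum_(n <oo) f n t).
Proof.
move=> mf; pose S n t := \sum_(0 <= k < n) f k t.
have mS n : measurable_fun setT (S n) by apply: emeasurable_sum.
have ms := measurable_fun_limn_esup mS.
have mi : measurable_fun setT (fun t => limn_einf (S ^~ t)).
  rewrite (_ : (fun _ => _) = (fun t => - limn_esup (fun n => - S n t))).
    apply: measurableT_comp => //; apply: measurable_fun_limn_esup => n.
    exact: measurableT_comp.
  apply/funext => t; rewrite -limn_einfN; congr limn_einf.
  by apply/funext => n /=; rewrite oppeK.
rewrite (_ : (fun _ => _) = (fun t => if limn_einf (S ^~ t) == limn_esup (S ^~ t)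
    then limn_esup (S ^~ t) else point)).
  by apply: measurable_fun_ifT => //; exact: measurable_fun_eqe.
apply/funext => t; case: ifPn => [/eqP/limn_einf_esup_cvg cS|/eqP h].
  by rewrite is_cvg_limn_esupE.
apply: dvgP => cS; apply: h.
by rewrite is_cvg_limn_esupE ?is_cvg_limn_einfE.
Qed.

End eseries_measurable.

Section esum_countType.
Local Open Scope ereal_scope.
Context {R : realType} {I : countType}.

(** Enumeration by codes; numbers that code nothing contribute 0. It carries results on series over
    to sums over strings. *)
Lemma esum_countE (D : set I) (a : I -> \bar R) : (forall i, D i -> 0 <= a i) ->
  \esum_(i in D) a i =
  \sum_(n <oo) oapp (fun i => if i \in D then a i else 0) 0 (pickle_inv n).
Proof.
move=> a0; rewrite esum_mkcond.
set b := fun i => if i \in D then a i else 0.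
have b0 i : 0 <= b i by rewrite /b; case: ifPn => // /[!inE] /a0.
rewrite nneseries_esumT; last by move=> n; case: pickle_inv.
transitivity (\esum_(n in range (fun i : I => choice.pickle i)) oapp b 0 (pickle_inv n)).
  rewrite esum_image; last by apply: in2W; exact: (pcan_inj choice.pickleK).
  by apply: eq_esum => i _; rewrite pickleK_inv.
rewrite esum_mkcond; apply: eq_esum => n _; case: ifPn => //.
case E : (pickle_inv n) => [i|]//= /negP[]; rewrite inE; exists i => //.
by have := @choice.pickle_invK I n; rewrite E.
Qed.

Lemma esumZl (D : set I) (r : R) (a : I -> \bar R) : (forall i, D i -> 0 <= a i) ->
  (0 <= r)%R ->
  \esum_(i in D) (r%:E * a i) = r%:E * \esum_(i in D) a i.
Proof.
move=> a0 r0; rewrite !esum_countE//; last by move=> i Di; rewrite mule_ge0 ?lee_fin ?a0.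
rewrite -nneseriesZl; last first.
  by move=> n _; case: pickle_inv => //= i; case: ifPn => // /[!inE] /a0.
apply: eq_eseriesr => n _; case: pickle_inv => [i|]/=; rewrite ?mule0//.
by case: ifPn; rewrite ?mule0.
Qed.

Context {d} {T : measurableType d}.

Lemma measurable_esum (D : set I) (f : I -> T -> \bar R) :
  (forall i t, D i -> 0 <= f i t) -> (forall i, D i -> measurable_fun setT (f i)) ->
  measurable_fun setT (fun t => \esum_(i in D) f i t).
Proof.
move=> f0 mf.
rewrite (_ : (fun _ => _) = (fun t => \sum_(n <oo)
   oapp (fun i => if i \in D then f i t else 0) 0 (pickle_inv n))).
  apply: measurable_eseries => n; case: pickle_inv => [i|]//=.
  by have [/set_mem/mf//|_] := boolP (i \in D); exact: measurable_cst.
by apply/funext => t; rewrite esum_countE// => i; exact: f0.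
Qed.

Lemma integral_esum (mu : {measure set T -> \bar R}) (D : set I) (f : I -> T -> \bar R) :
  (forall i t, D i -> 0 <= f i t) -> (forall i, D i -> measurable_fun setT (f i)) ->
  \int[mu]_t (\esum_(i in D) f i t) = \esum_(i in D) \int[mu]_t f i t.
Proof.
move=> f0 mf; rewrite [RHS]esum_countE; last first.
  by move=> i Di; apply: integral_ge0 => t _; exact: f0.
transitivity (\int[mu]_t (\sum_(n <oo)
    oapp (fun i => if i \in D then f i t else 0) 0 (pickle_inv n))).
  by apply: eq_integral => t _; rewrite esum_countE// => i; exact: f0.
rewrite integral_nneseries//.
- apply: eq_eseriesr => n _; case: pickle_inv => [i|]/=; last by rewrite integral0.
  by case: ifPn => // _; rewrite integral0.
- move=> n; case: pickle_inv => [i|]//=.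
  by have [/set_mem/mf//|_] := boolP (i \in D); exact: measurable_cst.
- move=> n t _; case: pickle_inv => [i|]//=.
  by case: ifPn => //; rewrite inE; exact: f0.
Qed.

End esum_countType.

(** * Weights of the nodes *)

(* A point x of env (node * nat) gives all the split vectors: x (v, i) is the
   i-th entry of the vector at v. *)
Section weights.
Context {R : realType}.
Implicit Type x : env (R := R) (node * nat).

Definition subtree (i : nat) x : env (R := R) (node * nat) :=
  fun vj => x (i :: vj.1, vj.2).

(** The recursion starts at the root so as to fit [subtree]; [weightE] gives the product along the
    path. *)
Fixpoint weight x (u : node) : R :=
  if u is i :: u' then x ([::], i) * weight (subtree i x) u' else 1.

Lemma weightE x u :
  weight x u = \prod_(j < size u) x (take j u, nth 0%N u j).
Proof.
elim: u x => [|i u IH] x /=; first by rewrite big_ord0.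
by rewrite big_ord_recl/= IH; congr (_ * _); apply: eq_bigr.
Qed.

(** This is [q_m], and [total] below is [Q], as functions of the environment with extended real
    values. *)
Definition level (m : nat) x : \bar R :=
  \esum_(u in [set u : node | size u = m]) ((weight x u) ^+ 2)%:E.

Definition total x : \bar R := (\sum_(1 <= m <oo) level m x)%E.

Lemma level_ge0 m x : (0 <= level m x)%E.
Proof. by apply: esum_ge0 => u _; rewrite lee_fin sqr_ge0. Qed.

Lemma total_ge0 x : (0 <= total x)%E.
Proof. by apply: nneseries_ge0 => m _ _; exact: level_ge0. Qed.

Lemma level0 x : level 0 x = 1%E.
Proof.
rewrite /level (_ : [set _ | _] = [set [::]]); last first.
  by apply/seteqP; split=> [[]|u ->].
by rewrite esum_set1 /= ?expr1n// lee_fin.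
Qed.

(** A string of length [m.+1] is a first letter and a string of length [m], and its weight factors
    accordingly. *)
Lemma levelS m x :
  level m.+1 x = (\sum_(i <oo) (x ([::], i) ^+ 2)%:E * level m (subtree i x))%E.
Proof.
rewrite nneseries_esumT; last first.
  by move=> i; rewrite mule_ge0 ?lee_fin ?sqr_ge0 ?level_ge0.
transitivity (\esum_(i in [set: nat]) \esum_(u in [set u : node | size u = m])
    ((x ([::], i) ^+ 2)%:E * ((weight (subtree i x) u) ^+ 2)%:E)%E); last first.
  by apply: eq_esum => i _; rewrite esumZl ?sqr_ge0// => u _; rewrite lee_fin sqr_ge0.
rewrite esum_esum; last first.
  by move=> i u _ _; rewrite mule_ge0 ?lee_fin ?sqr_ge0.
rewrite /level (reindex_esum ([set: nat] `*`` (fun=> [set u : node | size u = m])) _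
  (fun k : nat * node => k.1 :: k.2)).
  by apply: eq_esum => -[i u] _ /=; rewrite -EFinM exprMn.
split.
- by move=> [i u] /= [_ <-].
- by move=> [i u] [j v] _ _ /= [-> ->].
- by move=> [//|i u] /= [su]; exists (i, u).
Qed.

Lemma totalE x : total x = (\sum_(m <oo) level m.+1 x)%E.
Proof.
rewrite /total -(@nneseries_addn _ (level ^~ x) 1%N); last first.
  by move=> m; exact: level_ge0.
by under eq_eseriesr do rewrite addn1.
Qed.

(** Sum [levelS] over the levels and interchange; the summand 1 is level 0 of the subtree. This is
    the fixed point equation, pathwise. *)
Lemma total_rec x :
  total x = (\sum_(i <oo) (x ([::], i) ^+ 2)%:E * (1 + total (subtree i x)))%E.
Proof.
rewrite totalE; under eq_eseriesr do rewrite levelS.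
rewrite nneseries_interchange; last first.
  by move=> i j; rewrite mule_ge0 ?lee_fin ?sqr_ge0 ?level_ge0.
apply: eq_eseriesr => i _.
rewrite nneseriesZl; last by move=> m _; exact: level_ge0.
by rewrite nneseries_recl ?level0// => m _; exact: level_ge0.
Qed.

Lemma measurable_subtree i : measurable_fun setT (subtree i).
Proof. by apply: measurable_env => vj; exact: measurable_coord. Qed.

Lemma measurable_weight u : measurable_fun setT (fun x => weight x u).
Proof.
rewrite (_ : (fun _ => _) = fun x => \prod_(j < size u) x (take j u, nth 0%N u j)).
  by apply: measurable_prod => j _; exact: measurable_coord.
by apply/funext => x; rewrite weightE.
Qed.

Lemma measurable_level m : measurable_fun setT (level m).
Proof.
apply: measurable_esum => [u x _|u _]; first by rewrite lee_fin sqr_ge0.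
by apply/measurable_EFinP/measurable_funX; exact: measurable_weight.
Qed.

Lemma measurable_total : measurable_fun setT total.
Proof.
rewrite (_ : total = fun x => (\sum_(m <oo) level m.+1 x)%E).
  by apply: measurable_eseries => m; exact: measurable_level.
by apply/funext => x; exact: totalE.
Qed.

Lemma Q_series_total {T : Type} (V : node -> nat -> T -> R) t :
  Q_series V t = total (fun vi => V vi.1 vi.2 t).
Proof.
apply: eq_eseriesr => m _; rewrite /level.
rewrite (reindex_esum [set: m.-tuple nat] _ (fun s : m.-tuple nat => tval s)).
  apply: eq_esum => s _; rewrite weightE size_tuple; congr ((_ ^+ 2)%:E).
  by apply: eq_bigr => j _ /=; rewrite -tnth_nth.
split.
- by move=> s _ /=; rewrite size_tuple.
- by move=> s s' _ _ /val_inj.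
- by move=> u /= su; exists (Tuple (introT eqP su)).
Qed.

End weights.

(** * Independence and laws of the subtrees at the root *)

Lemma ge0_integral_eq_law {R : realType} {d1 d2 d'} {T1 : measurableType d1}
    {T2 : measurableType d2} {E : measurableType d'}
    (P1 : probability T1 R) (P2 : probability T2 R)
    (X1 : T1 -> E) (X2 : T2 -> E) (g : E -> \bar R) :
  measurable_fun setT X1 -> measurable_fun setT X2 ->
  (forall B, measurable B -> P1 (X1 @^-1` B) = P2 (X2 @^-1` B)) ->
  measurable_fun setT g -> (forall x, 0 <= g x)%E ->
  (\int[P1]_t g (X1 t) = \int[P2]_t g (X2 t))%E.
Proof.
move=> mX1 mX2 X12 mg g0.
pose Y1 : {mfun T1 >-> E} := HB.pack X1 (isMeasurableFun.Build _ _ _ _ X1 mX1).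
pose Y2 : {mfun T2 >-> E} := HB.pack X2 (isMeasurableFun.Build _ _ _ _ X2 mX2).
rewrite -[LHS](ge0_integral_distribution Y1 mg g0).
rewrite -[RHS](ge0_integral_distribution Y2 mg g0).
by apply: eq_measure_integral => B mB _; exact: X12.
Qed.

Lemma setI_closed_preimage {aT rT : Type} (f : aT -> rT) (G : set (set rT)) :
  setI_closed G -> setI_closed (preimage_set_system setT f G).
Proof.
move=> GI _ _ [A GA <-] [B GB <-]; exists (A `&` B); first exact: GI.
by rewrite !setTI preimage_setI.
Qed.

Section blocks.
Context {R : realType}.

Definition block (v : node) (x : env (R := R) (node * nat)) : env (R := R) nat :=
  fun j => x (v, j).

Lemma measurable_block v : measurable_fun setT (block v).
Proof. by apply: measurable_env => j; exact: measurable_coord. Qed.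

(** Puts the sigma-algebra into the form required by [eq_law_independent], with one generating
    system per node. *)
Lemma measurable_env_blocks :
  @measurable _ (env (R := R) (node * nat)) =
  <<s \bigcup_v preimage_set_system setT (block v) measurable >>.
Proof.
apply/seteqP; split.
  apply: smallest_sub; first exact: smallest_sigma_algebra.
  move=> _ [[v j] _ [B mB <-]]; apply: sub_sigma_algebra; exists v => //.
  exists [set y : env nat | B (y j)]; last by rewrite !setTI.
  by have := @measurable_coord R nat j measurableT B mB; rewrite setTI.
apply: smallest_sub; first exact: sigma_algebra_measurable.
by move=> _ [v _ [B mB <-]]; exact: measurable_block.
Qed.

End blocks.

Section iid_tree.
Context {R : realType} {d0 d} {T0 : measurableType d0} {T : measurableType d}.
Context {P0 : probability T0 R} {p : nat -> {RV P0 >-> R}}.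
Context {P : probability T R} {V : node -> nat -> {RV P >-> R}}.
Hypothesis V_iid : iid_copies P0 p P V.

Definition tree_env (t : T) : env (R := R) (node * nat) := fun vi => V vi.1 vi.2 t.

Lemma measurable_tree_env : measurable_fun setT tree_env.
Proof. by apply: measurable_env => -[v i] /=. Qed.

Lemma sigma_rv_measurable {I : Type} (X : I -> T -> R) :
  (forall i, measurable_fun setT (X i)) -> sigma_rv X `<=` measurable.
Proof.
move=> mX; apply: smallest_sub; first exact: sigma_algebra_measurable.
by move=> _ [i _ [B mB <-]]; exact: mX.
Qed.

Lemma measurable_subtree_env i : measurable_fun setT (subtree i \o tree_env).
Proof. by apply: measurableT_comp; [exact: measurable_subtree|exact: measurable_tree_env]. Qed.

(** The vectors at the nodes [i :: v] are again independent copies of the split vector, and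
    [eq_law_independent] applies. *)
Lemma subtree_law i B : measurable B ->
  P (tree_env @^-1` B) = P ((subtree i \o tree_env) @^-1` B).
Proof.
have [V_law V_ind] := V_iid.
have pre (Y : T -> env (node * nat)) (f : node -> node) v :
    (forall t vj, Y t vj = V (f vj.1) vj.2 t) ->
    preimage_set_system setT Y (preimage_set_system setT (block v) measurable)
     `<=` sigma_rv (V (f v)).
  move=> YE _ [_ [B' mB' <-] <-]; rewrite !setTI.
  rewrite (_ : _ @^-1` _ = [set t | B' ((fun j => V (f v) j : T -> R)^~ t)]).
    exact: sigma_rv_preimage.
  apply/seteqP; split => t /=; rewrite /block; congr B'; apply/funext => j;
   by rewrite YE.
apply: (eq_law_independent P P _ _ _ (fun v => preimage_set_system setT (block v) measurable)).
- exact: measurable_tree_env.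
- exact: measurable_subtree_env.
- exact: measurable_env_blocks.
- by move=> v; apply: setI_closed_preimage => A A' ? ?; exact: measurableI.
- by apply: independent_sub V_ind => v; exact: (pre _ id).
- apply: (@independent_sub _ _ _ _ _ _ (fun v => sigma_rv (V (i :: v)))).
    by move=> v; exact: (pre _ (cons i)).
  move=> J E VE.
  pose E' v := if v is j :: v' then E v' else setT.
  have := V_ind [fset i :: v | v in J]%fset E'.
  rewrite !bigcap_fset !big_imfset/=; try by move=> ? ? _ _ [].
  by apply => v /imfsetP[v' /= v'J ->]; exact: VE.
- move=> v _ [B' mB' <-]; rewrite !setTI.
  by have := V_law v B' mB'; have := V_law (i :: v) B' mB' => <-.
Qed.

(** Nodes are grouped by first letter: [ohead] sends the root to [None] and the subtree at child [i]
    to [Some i]. *)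
Lemma independent_subtrees :
  independent P (fun o : option nat =>
    if o is Some i
    then preimage_set_system setT (subtree i \o tree_env) measurable
    else sigma_rv (V [::])).
Proof.
have [V_law V_ind] := V_iid.
have := @independent_group _ _ _ P _ _ ohead _ _ _ _ V_ind.
move=> indG; apply: independent_sub (indG _ _ _).
- move=> [i|].
    move=> _ [B mB <-]; rewrite setTI.
    have := sigma_rv_preimage _ _ (fun vj t => V (i :: vj.1) vj.2 t) _ mB.
    apply: smallest_sub; first exact: smallest_sigma_algebra.
    move=> _ [[v j] _ [A mA <-]]; apply: sub_sigma_algebra; exists (i :: v) => //.
    by apply: sub_sigma_algebra; exists j => //; exists A.
  by move=> A ?; apply: sub_sigma_algebra; exists [::].
- by move=> v; exact: sigma_rv_measurable.
- move=> v A B; exact: (@measurableI _ (g_sigma_algebraType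
    (\bigcup_j preimage_set_system setT (V v j) measurable))).
- move=> v; exact: (@measurableT _ (g_sigma_algebraType
    (\bigcup_j preimage_set_system setT (V v j) measurable))).
Qed.

(** The root vector is independent of the subtree, and the subtree is distributed like the whole
    tree. *)
Lemma root_split_subtree (f : env nat -> R) (g : env (node * nat) -> \bar R) i :
  measurable_fun setT f -> (forall y, 0 <= f y) ->
  measurable_fun setT g -> (forall x, 0 <= g x)%E ->
  (\int[P]_t (f (block [::] (tree_env t)))%:E < +oo)%E ->
  (\int[P]_t (g (subtree i (tree_env t)) * (f (block [::] (tree_env t)))%:E) =
   \int[P]_t g (tree_env t) * \int[P]_t (f (block [::] (tree_env t)))%:E)%E.
Proof.
move=> mf f0 mg g0 fi.
have mb : measurable_fun setT (block [::] \o tree_env).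
  by apply: measurableT_comp; [exact: measurable_block|exact: measurable_tree_env].
rewrite (independent_integralM P (block [::] \o tree_env) (subtree i \o tree_env))//.
- congr (_ * _)%E; apply/esym.
  apply: (ge0_integral_eq_law P P tree_env (subtree i \o tree_env)) => //.
  + exact: measurable_tree_env.
  + exact: measurable_subtree_env.
  + exact: subtree_law.
- exact: measurable_subtree_env.
- move=> A B mA mB.
  apply: (independent_pair P _ _ None (Some i) _ _ independent_subtrees isT).
    exact: (sigma_rv_preimage _ _ (V [::])).
  by exists B; rewrite ?setTI.
Qed.

End iid_tree.

(** * Second moments of the split vector and of the levels *)

Lemma nneseries_ge_term {R : realType} (f : nat -> \bar R) i :
  (forall k, 0 <= f k)%E -> (f i <= \sum_(k <oo) f k)%E.
Proof.
move=> f0; rewrite (@nneseriesD1 _ f i xpredT)// leeDl//.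
exact: nneseries_ge0.
Qed.

Section second_moment.
Local Open Scope ereal_scope.
Context {R : realType} {d} {T : measurableType d} {P : probability T R}.
Context {p : nat -> {RV P >-> R}}.

Lemma measurable_sum_sqr :
  measurable_fun setT (fun t => \sum_(i <oo) (p i t ^+ 2)%:E).
Proof.
by apply: measurable_eseries => i; apply/measurable_EFinP/measurable_funX.
Qed.

(** Almost surely 1 minus the sum of the [P_i^2] is the sum of the [P_i (1 - P_i)], which is
    positive as soon as some [P_i] lies strictly between 0 and 1. *)
Lemma second_moment_lt1 : split_vector P p ->
  0 < P [set t | exists i, (0 < p i t < 1)%R] ->
  0 <= \int[P]_t \sum_(i <oo) (p i t ^+ 2)%:E < 1.
Proof.
move=> p_split p_nontrivial.
pose f t := \sum_(i <oo) (p i t ^+ 2)%:E.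
(* The maximum keeps [q] nonnegative everywhere; [0 <= p i t <= 1] holds only almost surely. *)
pose q i t := (Num.max (p i t - p i t ^+ 2) 0)%R.
pose g t := \sum_(i <oo) (q i t)%:E.
have q0 i t : (0 <= q i t)%R by rewrite /q le_max lexx orbT.
have f0 t : 0 <= f t by apply: nneseries_ge0 => i _ _; rewrite lee_fin sqr_ge0.
have g0 t : 0 <= g t by apply: nneseries_ge0 => i _ _; rewrite lee_fin.
have mf : measurable_fun setT f by exact: measurable_sum_sqr.
have mg : measurable_fun setT g.
  apply: measurable_eseries => i; apply/measurable_EFinP/measurable_maxr => //.
  by apply: measurable_funB => //; exact: measurable_funX.
have fg1 : {ae P, forall t, f t + g t = 1}.
  apply: filterS p_split => t [p0 p1].
  have ple1 i : (p i t <= 1)%R.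
    rewrite -lee_fin -p1; apply: (nneseries_ge_term (fun k => (p k t)%:E)) => k.
    by rewrite lee_fin.
  rewrite /f /g -nneseriesD; try by move=> *; rewrite lee_fin ?sqr_ge0.
  rewrite -p1; apply: eq_eseriesr => i _; rewrite -EFinD /q max_l.
    by rewrite addrC subrK.
  by rewrite subr_ge0 expr2 ler_piMr.
have intfg : \int[P]_t f t + \int[P]_t g t = 1.
  rewrite -ge0_integralD//.
  rewrite (@ge0_ae_eq_integral _ _ _ _ _ _ (cst 1))//.
  - by rewrite integral_cst// mul1e; exact: probability_setT.
  - exact: emeasurable_funD.
  - by move=> t _; rewrite adde_ge0.
  - by apply: filterS fg1 => t + _.
have if0 : 0 <= \int[P]_t f t by apply: integral_ge0.
have ig0 : 0 <= \int[P]_t g t by apply: integral_ge0.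
have iffin : \int[P]_t f t \is a fin_num.
  rewrite ge0_fin_numE//; apply: (@le_lt_trans _ _ 1); last exact: ltry.
  by rewrite -intfg leeDl.
rewrite if0/= -[X in _ < X]intfg lteDl// lt_def ig0 andbT.
apply/eqP => ig.
have /(ae_eq_integral_abs P measurableT mg) : \int[P]_t `|g t| = 0.
  by rewrite -[RHS]ig; apply: eq_integral => t _; rewrite gee0_abs.
move=> gae; move: p_nontrivial.
suff -> : P [set t | exists i, (0 < p i t < 1)%R] = 0 by rewrite ltxx.
apply/negligibleP.
  rewrite (_ : [set _ | _] = \bigcup_i (p i @^-1` [set` `]0%R, 1%R[ ])).
    apply: bigcupT_measurable => i; rewrite -[X in measurable X]setTI.
    exact: measurable_funP.
  by apply/seteqP; split => t [i]; [exists i => //=; rewrite in_itv|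
     move=> _ /=; rewrite in_itv; exists i].
have [N [mN N0 gN]] := gae.
exists N; split => // t /= [i pi]; apply: gN => /= /(_ I) gt0.
have : (q i t)%:E <= g t.
  by apply: (nneseries_ge_term (fun k => (q k t)%:E)) => k; rewrite lee_fin.
rewrite gt0 lee_fin leNgt /q lt_max subr_gt0 expr2.
by case/andP: pi => pi0 pi1; rewrite gtr_pMr// pi1.
Qed.

End second_moment.

Section level_moments.
Local Open Scope ereal_scope.
Context {R : realType} {d0 d} {T0 : measurableType d0} {T : measurableType d}.
Context {P0 : probability T0 R} {p : nat -> {RV P0 >-> R}}.
Context {P : probability T R} {V : node -> nat -> {RV P >-> R}}.
Hypothesis V_iid : iid_copies P0 p P V.
Variable a : R.
Hypothesis aE : \int[P0]_t \sum_(i <oo) (p i t ^+ 2)%:E = a%:E.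

Lemma sum_integral_root_sqr :
  \sum_(i <oo) \int[P]_t (V [::] i t ^+ 2)%:E = a%:E.
Proof.
rewrite -integral_nneseries//; last 2 first.
- by move=> i; apply/measurable_EFinP/measurable_funX.
- by move=> i t _; rewrite lee_fin sqr_ge0.
rewrite -aE.
have [V_law _] := V_iid.
apply: (@ge0_integral_eq_law _ _ _ _ _ _ (env nat) P P0 (fun t i => V [::] i t)
  (fun t i => p i t) (fun y : env nat => \sum_(i <oo) (y i ^+ 2)%:E)).
- exact: measurable_env.
- exact: measurable_env.
- by move=> B mB; exact: V_law.
- apply: measurable_eseries => i; apply/measurable_EFinP/measurable_funX.
  exact: measurable_coord.
- by move=> y; apply: nneseries_ge0 => i _ _; rewrite lee_fin sqr_ge0.
Qed.

(** Induction on [m]: splitting at the root, each child contributes the mean of [P_i^2] times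
    [a ^+ m]. *)
Lemma integral_level m : \int[P]_t level m (tree_env (V := V) t) = (a ^+ m)%:E.
Proof.
have mlevel k : measurable_fun setT (level (R := R) k) by exact: measurable_level.
elim: m => [|m IH].
  under eq_integral do rewrite level0.
  by rewrite integral_cst// mul1e expr0; exact: probability_setT.
under eq_integral do rewrite levelS.
rewrite integral_nneseries//; last 2 first.
- move=> i; apply: emeasurable_funM.
    by apply/measurable_EFinP/measurable_funX.
  exact: (measurableT_comp (mlevel m) (measurable_subtree_env i)).
- by move=> i t _; rewrite mule_ge0 ?lee_fin ?sqr_ge0 ?level_ge0.
transitivity (\sum_(i <oo) (a ^+ m)%:E * \int[P]_t (V [::] i t ^+ 2)%:E).
  apply: eq_eseriesr => i _; rewrite -IH.
  under eq_integral do rewrite muleC.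
  apply: (root_split_subtree V_iid (fun y => (y i ^+ 2)%R) (level m)) => //.
  - by apply: measurable_funX; exact: measurable_coord.
  - by move=> y; exact: sqr_ge0.
  - by move=> x; exact: level_ge0.
  apply: (@le_lt_trans _ _ a%:E); last exact: ltry.
  rewrite -sum_integral_root_sqr.
  apply: (nneseries_ge_term (fun k => \int[P]_t (V [::] k t ^+ 2)%:E)) => k.
  by apply: integral_ge0 => t _; rewrite lee_fin sqr_ge0.
rewrite nneseriesZl; last first.
  by move=> i _; apply: integral_ge0 => t _; rewrite lee_fin sqr_ge0.
by rewrite sum_integral_root_sqr exprSr.
Qed.

Hypothesis a01 : (0 <= a < 1)%R.

Lemma integral_total : \int[P]_t total (tree_env (V := V) t) = (a / (1 - a))%:E.
Proof.
under eq_integral do rewrite totalE.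
rewrite integral_nneseries//; last 2 first.
- move=> i; apply: measurableT_comp; [exact: measurable_level|exact: measurable_tree_env].
- by move=> i t _; exact: level_ge0.
under eq_eseriesr do rewrite integral_level.
apply/cvg_lim => //.
rewrite (_ : (fun _ => _) = EFin \o series (geometric a a)); last first.
  apply/funext => n /=; rewrite /series/= -sumEFin big_mkord.
  by rewrite big_mkord; apply: eq_bigr => i _; rewrite exprS.
apply/cvg_EFin => //; first by apply: nearW.
apply: cvg_geometric_series; case/andP: a01 => a0 a1; by rewrite ger0_norm.
Qed.

End level_moments.

Lemma esum_single {R : realType} {I : choiceType} (D : set I) (a : I -> \bar R) i :
  D i -> (forall j, D j -> j <> i -> a j = 0%E) -> (0 <= a i)%E ->
  \esum_(j in D) a j = a i.
Proof.
move=> Di a0 ai; rewrite -[RHS](esum_set1 ai) esum_mkcond [RHS]esum_mkcond.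
apply: eq_esum => j _; have [->|/eqP ji] := eqVneq j i.
  by rewrite !mem_set.
by rewrite [j \in [set i]]memNset//; case: ifPn => // /set_mem Dj; rewrite a0.
Qed.

(** * Rays *)

(* The ray of c is the path of a ball that never stops. *)
Section ray.
Implicit Type c : node -> nat.

Fixpoint ray c (m : nat) : node :=
  if m is m'.+1 then rcons (ray c m') (c (ray c m')) else [::].

Lemma size_ray c m : size (ray c m) = m.
Proof. by elim: m => //= m IH; rewrite size_rcons IH. Qed.

Lemma take_ray c m j : (j <= m)%N -> take j (ray c m) = ray c j.
Proof.
elim: m => [|m IH]; first by rewrite leqn0 => /eqP ->.
rewrite leq_eqVlt => /orP[/eqP ->|]; first by rewrite take_oversize ?size_ray.
by rewrite ltnS => jm /=; rewrite -cats1 take_cat size_ray; case: ltngtP jm => // [jm _|-> _];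
  rewrite ?IH 1?ltnW// subnn take0 cats0.
Qed.

(** Passing through [u] is a condition on the choices at the proper prefixes of [u], the form to
    which [choices_given] applies. *)
Lemma ray_eqP c (u : node) :
  ray c (size u) = u <-> forall j, (j < size u)%N -> c (take j u) = nth 0%N u j.
Proof.
split=> [cu j ju|].
  have tu := take_ray c (size u) j (ltnW ju); rewrite cu in tu.
  have := take_ray c (size u) j.+1 ju; rewrite cu (take_nth 0%N ju) /= tu.
  by move/rcons_inj => [].
elim/last_ind: u => [//|u i IH] h; rewrite size_rcons /= IH.
  have := h (size u); rewrite size_rcons ltnSn => /(_ isT).
  by rewrite nth_rcons ltnn eqxx -cats1 take_size_cat// cats1 => ->.
move=> j ju; have := h j; rewrite size_rcons ltnS ltnW// => /(_ isT).
by rewrite nth_rcons ju -cats1 takel_cat// ltnW.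
Qed.

End ray.

(** * Probabilities of prescribed paths and of coincidences *)

Section paths.
Context {R : realType} {d} {T : measurableType d} {P : probability T R}.
Context {V : node -> nat -> {RV P >-> R}} {C : nat -> node -> {RV P >-> nat}}.

Definition choice_fun (k : nat) (t : T) : node -> nat := fun v => C k v t.

Definition path_event (k : nat) (u : node) : set T :=
  [set t | ray (choice_fun k t) (size u) = u].

Lemma path_eventE k u : path_event k u =
  \bigcap_(j in [set j | (j < size u)%N]) [set t | C k (take j u) t = nth 0%N u j].
Proof.
by apply/seteqP; split => t; [move/ray_eqP => h j /h|
  move=> h; apply/ray_eqP => j /h].
Qed.

Lemma measurable_path_event k u : measurable (path_event k u).
Proof.
rewrite path_eventE; apply: bigcap_measurableType => j _.
have := measurable_funP (C k (take j u)) measurableT [set nth 0%N u j] I.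
by rewrite setTI.
Qed.

Hypothesis C_given : choices_given P V C.

(* Distinct balls follow prescribed paths with the product of the weights as
   conditional probability. *)
Lemma paths_given (s : seq (nat * node)) (A : set T) :
  uniq (map fst s) ->
  sigma_rv (fun vi : node * nat => V vi.1 vi.2 : T -> R) A ->
  (P (A `&` \big[setI/setT]_(x <- s) path_event x.1 x.2) =
  \int[P]_(t in A) (\prod_(x <- s) weight (tree_env (V := V) t) x.2)%:E)%E.
Proof.
move=> us sA.
(* [S] lists the pairs of a ball and a node where its choice is prescribed. As the balls are
   distinct, [u_of] recovers the target of a ball, and the choice [c] is the letter of that target
   at the depth of the node. *)
pose g (x : nat * node) := [seq (x.1, take j x.2) | j <- iota 0 (size x.2)].
pose S := flatten (map g s).
pose u_of k := (nth (0%N, [::]) s (index k (map fst s))).2.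
have u_ofE x : x \in s -> u_of x.1 = x.2.
  move=> xs; have x1 : x.1 = nth 0%N (map fst s) (index x s).
    by rewrite (nth_map (0%N, [::])) ?index_mem// nth_index.
  by rewrite /u_of {1}x1 index_uniq ?size_map ?index_mem// nth_index.
pose c (y : nat * node) := nth 0%N (u_of y.1) (size y.2).
have uS : uniq S.
  rewrite /S; move: us; clear; elim: s => //= x s IH /andP[xs /IH us].
  rewrite cat_uniq us andbT; apply/andP; split.
    rewrite map_inj_in_uniq ?iota_uniq// => i j.
    rewrite !mem_iota /= !add0n => ix jx [] /(congr1 size).
    by rewrite !size_takel// ltnW.
  apply/hasPn => y /flattenP[_ /mapP[z zs ->]] /mapP[j _ ->]; apply/negP.
  by move=> /mapP[i _ [zx _]]; move: xs; rewrite -zx map_f.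
have pm : perm_eq [fset y in S]%fset S by apply: uniq_perm => // y; rewrite inE.
have := C_given [fset y in S]%fset c A sA.
rewrite (_ : \bigcap_(x in _) _ = \big[setI/setT]_(x <- s) path_event x.1 x.2).
  move=> ->; apply: eq_integral => t _; congr EFin.
  rewrite (perm_big _ pm)/= big_flatten/= big_map; apply: eq_big_seq => x xs.
  rewrite weightE big_map -val_enum_ord big_map big_enum.
  apply: eq_bigr => j _ /=.
  by rewrite /tree_env/= /c /= u_ofE// size_takel// ltnW.
rewrite -bigcap_seq; apply/seteqP; split => t.
  move=> h x /= xs; apply/ray_eqP => j jx.
  have /= := h (x.1, take j x.2); rewrite /c/= u_ofE// size_takel ?(ltnW jx)//; apply.
  rewrite inE; apply/flattenP; exists (g x); first exact: map_f.
  by apply/mapP; exists j => //; rewrite mem_iota.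
move=> h y /=; rewrite inE => /flattenP[_ /mapP[x xs ->]] /mapP[j].
rewrite mem_iota add0n => /= jx -> /=.
have /ray_eqP hx := h x xs; rewrite /c /= u_ofE// size_takel ?(ltnW jx)//.
exact: hx.
Qed.

Definition coincide (m k l : nat) (t : T) : bool :=
  ray (choice_fun k t) m == ray (choice_fun l t) m.

Definition path_event2 (k l : nat) (u : node) : set T :=
  path_event k u `&` path_event l u.

Lemma measurable_path_event2 k l u : measurable (path_event2 k l u).
Proof. by apply: measurableI; exact: measurable_path_event. Qed.

(** A ray has exactly one node on each level, so at most one term is nonzero. This reduces
    coincidences to path events. *)
Lemma coincideE m k l t : ((coincide m k l t)%:R)%:E =
  \esum_(u in [set u : node | size u = m]) (\1_(path_event2 k l u) t)%:E :> \bar R.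
Proof.
rewrite /coincide; case: eqP => [kl|kl].
  rewrite (esum_single _ _ (ray (choice_fun k t) m)) ?lee_fin//=.
  - rewrite indicE mem_set//; split; rewrite /path_event/= size_ray// -kl.
  - exact: size_ray.
  - move=> u /= <- uk; rewrite indicE memNset// => -[ku _].
    by apply: uk; rewrite ku.
rewrite esum1//= => u um; rewrite indicE memNset// => -[ku lu].
by apply: kl; rewrite -um ku lu.
Qed.

Lemma measurable_coincide m k l :
  measurable_fun setT (fun t => (coincide m k l t)%:R : R).
Proof.
apply/measurable_EFinP.
rewrite (_ : _ \o _ = fun t =>
  \esum_(u in [set u : node | size u = m]) (\1_(path_event2 k l u) t)%:E).
  apply: measurable_esum => [u t _|u _]; first by rewrite lee_fin.
  by apply/measurable_EFinP/measurable_indic; exact: measurable_path_event2.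
by apply/funext => t /=; rewrite coincideE.
Qed.

(** Given the vectors, two distinct balls both pass through [u] with probability [w(u)^2]. *)
Lemma integral_path2 (f : env (R := R) (node * nat) -> R) k l u : k != l ->
  measurable_fun setT f -> (forall x, 0 <= f x) ->
  (\int[P]_t (f (tree_env (V := V) t) * \1_(path_event2 k l u) t)%:E =
   \int[P]_t (f (tree_env (V := V) t) * weight (tree_env (V := V) t) u ^+ 2)%:E)%E.
Proof.
move=> kl mf f0.
under eq_integral do rewrite EFinM.
under [RHS]eq_integral do rewrite EFinM.
have mw : measurable_fun setT (fun t => weight (tree_env (V := V) t) u ^+ 2).
  apply: measurable_funX; apply: (measurableT_comp (measurable_weight u)).
  exact: measurable_tree_env.
apply: (ge0_integral_factor P _ measurable_tree_env _ _ (EFin \o f)) => //.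
- by apply: measurable_indic; exact: measurable_path_event2.
- by move=> t; exact: sqr_ge0.
- move=> B mB; rewrite integral_indic//; last 2 first.
  + by rewrite -[X in measurable X]setTI; exact: measurable_tree_env.
  + exact: measurable_path_event2.
  have := paths_given [:: (k, u); (l, u)] (tree_env (V := V) @^-1` B).
  rewrite !big_cons big_nil setIT /= inE kl => /(_ isT).
  rewrite setIC => -> //; last exact: (sigma_rv_preimage _ _ (fun vi => V vi.1 vi.2)).
  by apply: eq_integral => t _; rewrite !big_cons big_nil mulr1.
- exact/measurable_EFinP.
Qed.

Lemma integral_path4 k l k' l' u u' : uniq [:: k; l; k'; l'] ->
  (\int[P]_t (\1_(path_event2 k l u) t * \1_(path_event2 k' l' u') t)%:E =
   \int[P]_t (weight (tree_env (V := V) t) u ^+ 2 *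
              weight (tree_env (V := V) t) u' ^+ 2)%:E)%E.
Proof.
move=> ukl.
have := paths_given [:: (k, u); (l, u); (k', u'); (l', u')] setT ukl.
rewrite setTI !big_cons big_nil setIT /= => h.
transitivity (\int[P]_t (\1_(path_event2 k l u `&` path_event2 k' l' u') t)%:E)%E.
  by apply: eq_integral => t _; rewrite indicI.
rewrite integral_indic//; last by apply: measurableI; exact: measurable_path_event2.
rewrite setIT /path_event2 !setIA; rewrite !setIA in h; rewrite [LHS]h.
  by apply: eq_integral => t _; rewrite !big_cons big_nil mulr1 !expr2 !mulrA.
have := sigma_rv_preimage _ _ (fun vi => V vi.1 vi.2 : T -> R) setT measurableT.
by rewrite [X in sigma_rv _ X](_ : _ = setT)//; apply/seteqP; split.
Qed.

Lemma integral_coincide (f : env (R := R) (node * nat) -> R) m k l : k != l ->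
  measurable_fun setT f -> (forall x, 0 <= f x) ->
  (\int[P]_t (f (tree_env (V := V) t) * (coincide m k l t)%:R)%:E =
   \int[P]_t ((f (tree_env (V := V) t))%:E * level m (tree_env (V := V) t)))%E.
Proof.
move=> kl mf f0.
have mfV : measurable_fun setT (fun t => f (tree_env (V := V) t)).
  by apply: measurableT_comp => //; exact: measurable_tree_env.
transitivity (\int[P]_t \esum_(u in [set u : node | size u = m])
    (f (tree_env (V := V) t) * \1_(path_event2 k l u) t)%:E)%E.
  apply: eq_integral => t _; by rewrite EFinM coincideE -esumZl.
rewrite integral_esum; last 2 first.
- by move=> u t _; rewrite lee_fin mulr_ge0.
- move=> u _; apply/measurable_EFinP/measurable_funM => //.
  by apply: measurable_indic; exact: measurable_path_event2.
transitivity (\int[P]_t \esum_(u in [set u : node | size u = m])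
    (f (tree_env (V := V) t) * weight (tree_env (V := V) t) u ^+ 2)%:E)%E.
  rewrite integral_esum.
  - by apply: eq_esum => u _; exact: integral_path2.
  - by move=> u t _; rewrite lee_fin mulr_ge0 ?sqr_ge0.
  - move=> u _; apply/measurable_EFinP/measurable_funM => //.
    apply: measurable_funX; apply: (measurableT_comp (measurable_weight u)).
    exact: measurable_tree_env.
apply: eq_integral => t _; rewrite /level -esumZl//.
by move=> u _; rewrite lee_fin sqr_ge0.
Qed.

(** The right-hand side is the mean of [q_m^2], expanded into a double sum so that [integral_path4]
    applies to each term. *)
Lemma integral_coincide2 m k l k' l' : uniq [:: k; l; k'; l'] ->
  (\int[P]_t ((coincide m k l t)%:R * (coincide m k' l' t)%:R)%:E =
   \int[P]_t (\esum_(u in [set u : node | size u = m])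
     \esum_(v in [set u : node | size u = m])
      (weight (tree_env (V := V) t) u ^+ 2 *
              weight (tree_env (V := V) t) v ^+ 2)%:E))%E.
Proof.
move=> ukl.
have mi u v : measurable_fun setT (fun t =>
    (\1_(path_event2 k l u) t * \1_(path_event2 k' l' v) t)%:E : \bar R).
  apply/measurable_EFinP/measurable_funM; apply: measurable_indic;
    exact: measurable_path_event2.
have mw u : measurable_fun setT (fun t => weight (tree_env (V := V) t) u ^+ 2).
  apply: measurable_funX; apply: (measurableT_comp (measurable_weight u)).
  exact: measurable_tree_env.
transitivity (\int[P]_t (\esum_(u in [set u : node | size u = m])
     \esum_(v in [set u : node | size u = m])
   (\1_(path_event2 k l u) t * \1_(path_event2 k' l' v) t)%:E))%E.
  apply: eq_integral => t _; rewrite EFinM [X in (X * _)%E]coincideE muleC -esumZl//.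
    apply: eq_esum => u _; rewrite muleC coincideE -esumZl//.
rewrite !integral_esum.
- apply: eq_esum => u _; rewrite !integral_esum.
  + by apply: eq_esum => v _; exact: integral_path4.
  + by move=> v t _; rewrite lee_fin mulr_ge0 ?sqr_ge0.
  + by move=> v _; apply/measurable_EFinP/measurable_funM.
  + by move=> v t _; rewrite lee_fin mulr_ge0.
  + by [].
- by move=> u t _; apply: esum_ge0 => v _; rewrite lee_fin mulr_ge0 ?sqr_ge0.
- move=> u _; apply: measurable_esum => [v t _|v _].
    by rewrite lee_fin mulr_ge0 ?sqr_ge0.
  by apply/measurable_EFinP/measurable_funM.
- by move=> u t _; apply: esum_ge0 => v _; rewrite lee_fin mulr_ge0.
- by move=> u _; apply: measurable_esum => [v t _|//]; rewrite lee_fin mulr_ge0.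
Qed.

End paths.

(** * Variance of the number of coincidences *)

Lemma ge0_integral_lty_ae {R : realType} {d} {T : measurableType d}
    (mu : {measure set T -> \bar R}) (f : T -> \bar R) :
  measurable_fun setT f -> (forall t, 0 <= f t)%E -> (\int[mu]_t f t < +oo)%E ->
  {ae mu, forall t, f t \is a fin_num}.
Proof.
move=> mf f0 fi; have : mu.-integrable setT f.
  apply/integrableP; split => //; apply: le_lt_trans fi.
  by under eq_integral do rewrite gee0_abs//.
by move/(integrable_ae measurableT); apply: filterS => t; exact.
Qed.

Section variance.
Context {R : realType} {d0 d} {T0 : measurableType d0} {T : measurableType d}.
Context {P0 : probability T0 R} {p : nat -> {RV P0 >-> R}}.
Context {P : probability T R} {V : node -> nat -> {RV P >-> R}}.
Context {C : nat -> node -> {RV P >-> nat}}.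
Hypotheses (V_iid : iid_copies P0 p P V) (C_given : choices_given P V C).
Variable a : R.
Hypothesis aE : (\int[P0]_t \sum_(i <oo) (p i t ^+ 2)%:E = a%:E)%E.

(** The real version of [q_m], with value 0 where the level sum is infinite, a null event by
    [ae_qlevelE]. *)
Definition qlevel (m : nat) (t : T) : R := fine (level m (tree_env (V := V) t)).

Lemma qlevel_ge0 m t : 0 <= qlevel m t.
Proof. by apply: fine_ge0; exact: level_ge0. Qed.

Lemma measurable_qlevel m : measurable_fun setT (qlevel m).
Proof.
apply: measurableT_comp => //; apply: (measurableT_comp (measurable_level m)).
exact: measurable_tree_env.
Qed.

Lemma ae_qlevelE m : {ae P, forall t, level m (tree_env (V := V) t) = (qlevel m t)%:E}.
Proof.
have : {ae P, forall t, level m (tree_env (V := V) t) \is a fin_num}.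
  apply: ge0_integral_lty_ae => [|t|]; last by rewrite (integral_level V_iid a aE) ltry.
    by apply: (measurableT_comp (measurable_level m)); exact: measurable_tree_env.
  exact: level_ge0.
by apply: filterS => t ?; rewrite fineK.
Qed.

Lemma expectation_coincide m k l : k != l ->
  (\int[P]_t ((coincide (C := C) m k l t)%:R)%:E = (a ^+ m)%:E)%E.
Proof.
move=> kl; have := integral_coincide C_given (fun=> 1) m k l kl.
under eq_integral do rewrite mul1r.
under [RHS]eq_integral do rewrite mul1e.
by rewrite (integral_level V_iid a aE) => -> //; exact: measurable_cst.
Qed.

Lemma expectation_qlevel_coincide m k l : k != l ->
  (\int[P]_t (qlevel m t * (coincide (C := C) m k l t)%:R)%:E =
   \int[P]_t (qlevel m t ^+ 2)%:E)%E.
Proof.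
move=> kl; rewrite (integral_coincide C_given (fun x => fine (level m x)) m k l kl).
- apply: ge0_ae_eq_integral => //.
  + apply: emeasurable_funM; first by apply/measurable_EFinP; exact: measurable_qlevel.
    by apply: (measurableT_comp (measurable_level m)); exact: measurable_tree_env.
  + by apply/measurable_EFinP/measurable_funX; exact: measurable_qlevel.
  + by move=> t _; rewrite mule_ge0 ?lee_fin ?level_ge0 ?fine_ge0 ?level_ge0.
  + by move=> t _; rewrite lee_fin sqr_ge0.
  + by apply: filterS (ae_qlevelE m) => t qE _; rewrite qE.
- by apply: measurableT_comp => //; exact: measurable_level.
- by move=> x; rewrite fine_ge0 ?level_ge0.
Qed.

Lemma expectation_coincide2 m k l k' l' : uniq [:: k; l; k'; l'] ->
  (\int[P]_t ((coincide (C := C) m k l t)%:R * (coincide (C := C) m k' l' t)%:R)%:E =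
   \int[P]_t (qlevel m t ^+ 2)%:E)%E.
Proof.
move=> ukl; rewrite (integral_coincide2 C_given)//.
apply: ge0_ae_eq_integral => //.
- apply: measurable_esum => [u t _|u _].
    by apply: esum_ge0 => v _; rewrite lee_fin mulr_ge0 ?sqr_ge0.
  apply: measurable_esum => [v t _|v _]; first by rewrite lee_fin mulr_ge0 ?sqr_ge0.
  apply/measurable_EFinP; apply: measurable_funM; apply: measurable_funX;
    apply: (measurableT_comp (measurable_weight _)); exact: measurable_tree_env.
- by apply/measurable_EFinP/measurable_funX; exact: measurable_qlevel.
- move=> t _; apply: esum_ge0 => u _; apply: esum_ge0 => v _.
  by rewrite lee_fin mulr_ge0 ?sqr_ge0.
- by move=> t _; rewrite lee_fin sqr_ge0.
apply: filterS (ae_qlevelE m) => t qE _.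
transitivity (\esum_(u in [set u : node | size u = m])
    ((qlevel m t)%:E * (weight (tree_env (V := V) t) u ^+ 2)%:E))%E.
  apply: eq_esum => u _; rewrite -qE muleC -esumZl ?sqr_ge0//.
  by move=> v _; rewrite lee_fin sqr_ge0.
rewrite esumZl ?qlevel_ge0 -/(level _ _) ?qE//.
by move=> v _; rewrite lee_fin sqr_ge0.
Qed.

Lemma integral_coincide_le m k l k' l' : k != l ->
  (\int[P]_t ((coincide (C := C) m k l t)%:R * (coincide (C := C) m k' l' t)%:R)%:E
    <= (a ^+ m)%:E)%E.
Proof.
move=> kl; rewrite -(expectation_coincide m k l kl).
apply: ge0_le_integral => //.
- by apply/measurable_EFinP/measurable_funM; exact: measurable_coincide.
- by apply/measurable_EFinP; exact: measurable_coincide.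
- move=> t _; rewrite lee_fin.
  by case: coincide => /=; rewrite ?mul0r// mul1r; case: coincide; rewrite ?ler01.
Qed.

(** The mean of [q_m^2] is the probability that two disjoint pairs of balls both coincide, which is
    at most [a ^+ m]. *)
Lemma qlevel_sqr_lty m : (\int[P]_t (qlevel m t ^+ 2)%:E < +oo)%E.
Proof.
rewrite -(expectation_coincide2 m 0 1 2 3)//.
by apply: le_lt_trans (integral_coincide_le m 0 1 2 3 _) (ltry _).
Qed.

(** The [Z(m, n)] of the overview. *)
Definition coincidences (m n : nat) (t : T) : nat :=
  (\sum_(k < n) \sum_(l < n | k != l) coincide (C := C) m k l t)%N.

Lemma card_offdiag n : #|[pred x : 'I_n * 'I_n | x.1 != x.2]| = (n * n.-1)%N.
Proof.
rewrite -sum1_card -(pair_big_dep xpredT (fun i j : 'I_n => i != j) (fun _ _ => 1%N))/=.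
under eq_bigr => i _.
  rewrite sum1_card.
  rewrite (eq_card (B := predC1 i)); last by move=> j; rewrite !inE eq_sym.
  rewrite cardC1 card_ord.
over.
by rewrite sum_nat_const card_ord.
Qed.

(** Zero exactly when the two pairs share no ball. Each of the four equalities holds for [n] pairs
    [y], hence the [4 * n] in [sum_overlap]. *)
Let overlap n (x y : 'I_n * 'I_n) : nat :=
  (x.1 == y.1) + (x.1 == y.2) + ((x.2 == y.1) + (x.2 == y.2)).

Let sum_overlap n (x : 'I_n * 'I_n) : (\sum_y overlap n x y = 4 * n)%N.
Proof.
have h1 (i : 'I_n) : (\sum_(y : 'I_n * 'I_n) (i == y.1) = n)%N.
  rewrite -(pair_bigA _ (fun j k : 'I_n => (i == j : nat)))/=.
  rewrite (bigD1 i)//= eqxx sum_nat_const card_ord muln1.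
  rewrite [X in (_ + X)%N]big1 ?addn0// => j ji.
  by rewrite big1// => k _; rewrite eq_sym (negbTE ji).
have h2 (i : 'I_n) : (\sum_(y : 'I_n * 'I_n) (i == y.2) = n)%N.
  rewrite -(pair_bigA _ (fun j k : 'I_n => (i == k : nat)))/=.
  rewrite exchange_big -[RHS](h1 i) -(pair_bigA _ (fun j k : 'I_n => (i == j : nat))).
  by [].
by rewrite !big_split/= !h1 !h2; lia.
Qed.

(* Pairs of disjoint pairs of balls contribute what (n (n - 1) q)^2 takes away;
   at most 4 n^3 pairs of pairs are not disjoint. *)
Lemma variance_coincidences m n :
  (\int[P]_t (((coincidences m n t)%:R - (n * n.-1)%:R * qlevel m t) ^+ 2)%:E
   <= ((4 * n ^ 3)%:R * a ^+ m)%:E)%E.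
Proof.
pose s := enum [pred x : 'I_n * 'I_n | x.1 != x.2].
pose h (x : 'I_n * 'I_n) t : R := (coincide (C := C) m x.1 x.2 t)%:R.
have ss : size s = (n * n.-1)%N by rewrite -cardE card_offdiag.
have sP x : x \in s -> x.1 != x.2 :> nat by rewrite mem_enum inE.
have ZE t : (coincidences m n t)%:R = \sum_(x <- s) h x t :> R.
  rewrite /coincidences pair_big_dep natr_sum big_enum.
  by apply: eq_bigl => x; rewrite !inE.
have h0 x t : 0 <= h x t by [].
have mh x : measurable_fun setT (h x) by exact: measurable_coincide.
have mq := measurable_qlevel m.
have q0 := qlevel_ge0 m.
set c : R := (n * n.-1)%:R.
have c0 : 0 <= c by [].
have := qlevel_sqr_lty m.
set S := (\int[P]_t (qlevel m t ^+ 2)%:E)%E => S_lty.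
have S0 : (0 <= S)%E by apply: integral_ge0 => t _; rewrite lee_fin sqr_ge0.
have [sg SE] : exists sg, S = sg%:E by exists (fine S); rewrite fineK// ge0_fin_numE.
pose Z t := \sum_(x <- s) h x t.
have Z0 t : 0 <= Z t by apply: sumr_ge0.
have mZ : measurable_fun setT Z by apply: measurable_sum.
have sumcR (r : R) : \sum_(x <- s) r = c * r.
  by rewrite big_const_seq count_predT ss iter_addr_0 mulr_natl.
have sumc (r : R) : (\sum_(x <- s) r%:E = (c * r)%:E)%E by rewrite sumEFin sumcR.
have I1 : (\int[P]_t (Z t * qlevel m t)%:E = (c * sg)%:E)%E.
  transitivity (\int[P]_t \sum_(x <- s) (qlevel m t * h x t)%:E)%E.
    by apply: eq_integral => t _; rewrite sumEFin -mulr_sumr mulrC.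
  rewrite ge0_integral_sum//; last 2 first.
  - by move=> x; apply/measurable_EFinP/measurable_funM.
  - by move=> x t _; rewrite lee_fin mulr_ge0.
  rewrite -sumc; apply: eq_big_seq => x /sP xs.
  by rewrite expectation_qlevel_coincide.
have I2 : (\int[P]_t (Z t ^+ 2)%:E <= (c * (c * sg) + (4 * n ^ 3)%:R * a ^+ m)%:E)%E.
  apply: (@le_trans _ _ (\int[P]_t \sum_(x <- s) \sum_(y <- s) (h x t * h y t)%:E)%E).
    rewrite le_eqVlt; apply/orP; left; apply/eqP.
    apply: eq_integral => t _; rewrite expr2 /Z mulr_suml -sumEFin.
    by apply: eq_bigr => x _; rewrite mulr_sumr -sumEFin.
  rewrite ge0_integral_sum//; last 2 first.
  - move=> x; apply: emeasurable_sum => y.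
    by apply/measurable_EFinP/measurable_funM.
  - by move=> x t _; apply: sume_ge0 => y _; rewrite lee_fin mulr_ge0.
  have am0 : 0 <= a ^+ m.
    have := expectation_coincide m 0 1 isT; rewrite -lee_fin => <-.
    by apply: integral_ge0 => t _; rewrite lee_fin.
  have sg0 : 0 <= sg by rewrite -lee_fin -SE.
  (* Disjoint pairs contribute exactly [sg]; any other pair contributes at most [a ^+ m], paid for
     by an overlap of at least 1. *)
  have step x y : x \in s -> y \in s ->
    (\int[P]_t (h x t * h y t)%:E <= (sg + (overlap n x y)%:R * a ^+ m)%:E)%E.
    move=> /sP xs /sP ys; have [e0|e0] := posnP (overlap n x y).
      rewrite e0 mul0r addr0 -SE /h expectation_coincide2//.
      move: e0; rewrite /overlap /= !inE !negb_or xs ys /=.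
      by rewrite -!(inj_eq val_inj)/=; do 4 case: eqP.
    apply: le_trans (integral_coincide_le _ _ _ _ _ xs) _.
    rewrite lee_fin; apply: (@le_trans _ _ (sg + 1%:R * a ^+ m)).
      by rewrite mul1r lerDr.
    by rewrite lerD2l ler_wpM2r// ler_nat.
  apply: (@le_trans _ _ (\sum_(x <- s) (c * sg + (4 * n)%:R * a ^+ m)%:E)%E).
    rewrite big_seq [leRHS]big_seq; apply: lee_sum => x xs.
    rewrite ge0_integral_sum//; last 2 first.
    - by move=> y; apply/measurable_EFinP/measurable_funM.
    - by move=> y t _; rewrite lee_fin mulr_ge0.
    apply: (@le_trans _ _ (\sum_(y <- s) (sg + (overlap n x y)%:R * a ^+ m)%:E)%E).
      by rewrite big_seq [leRHS]big_seq; apply: lee_sum => y ys; exact: step.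
    rewrite sumEFin big_split/= sumcR lee_fin lerD2l.
    rewrite -mulr_suml ler_wpM2r// -natr_sum ler_nat -(sum_overlap n x).
    by rewrite big_enum/= [leqRHS](bigID (fun x => x.1 != x.2))/= leq_addr.
  rewrite sumc lee_fin mulrDr lerD2l mulrA ler_wpM2r// -natrM ler_nat.
  by rewrite !expnS expn0; nia.
set X := (\int[P]_t _)%E.
(* The expanded square, with the cross term moved to the left so that only nonnegative functions are
   integrated. *)
have X_id : (X + (2 * c * (c * sg))%:E = \int[P]_t (Z t ^+ 2)%:E + (c ^+ 2 * sg)%:E)%E.
  have -> : ((2 * c * (c * sg))%:E = \int[P]_t (2 * c * (Z t * qlevel m t))%:E)%E.
    under eq_integral do rewrite EFinM.
    rewrite ge0_integralZl//; first by rewrite I1.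
    - by apply/measurable_EFinP/measurable_funM.
    - by move=> t _; rewrite lee_fin mulr_ge0.
    - by rewrite lee_fin mulr_ge0.
  have -> : ((c ^+ 2 * sg)%:E = \int[P]_t (c ^+ 2 * qlevel m t ^+ 2)%:E)%E.
    under eq_integral do rewrite EFinM.
    rewrite ge0_integralZl//; first by rewrite -/S SE.
    - by apply/measurable_EFinP/measurable_funX.
    - by move=> t _; rewrite lee_fin sqr_ge0.
    - by rewrite lee_fin sqr_ge0.
  rewrite /X -!ge0_integralD//.
  - apply: eq_integral => t _; rewrite -!EFinD ZE -/(Z t) -/c; congr EFin.
    by ring.
  - by move=> t _; rewrite lee_fin sqr_ge0.
  - by apply/measurable_EFinP/measurable_funX.
  - by move=> t _; rewrite lee_fin mulr_ge0 ?sqr_ge0.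
  - apply/measurable_EFinP; apply: measurable_funM => //; exact: measurable_funX.
  - by move=> t _; rewrite lee_fin sqr_ge0.
  - apply/measurable_EFinP; apply: measurable_funX; apply: measurable_funB.
      by rewrite (_ : (fun _ => _) = Z)//; apply/funext => t; rewrite ZE.
    exact: measurable_funM.
  - by move=> t _; rewrite lee_fin !mulr_ge0.
  - by apply/measurable_EFinP; apply: measurable_funM => //; exact: measurable_funM.
rewrite -(@leeD2rE _ (2 * c * (c * sg))%:E)// X_id.
apply: (@le_trans _ _ ((c * (c * sg) + (4 * n ^ 3)%:R * a ^+ m)%:E + (c ^+ 2 * sg)%:E)%E).
  exact: leeD2r.
rewrite -!EFinD lee_fin le_eqVlt; apply/orP; left; apply/eqP; ring.
Qed.

End variance.

(** * Almost sure rate along fourth powers *)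

(** The double sum has finite integral, so it is finite almost everywhere and bounds each of its
    terms, uniformly in both indices. *)
Lemma ae_double_series_bounded {R : realType} {d} {T : measurableType d}
    (mu : {measure set T -> \bar R}) (f : nat -> nat -> T -> \bar R) :
  (forall m j, measurable_fun setT (f m j)) -> (forall m j t, 0 <= f m j t)%E ->
  (\sum_(m <oo) \sum_(j <oo) \int[mu]_t f m j t < +oo)%E ->
  {ae mu, forall t, exists r : R, forall m j, (f m j t <= r%:E)%E}.
Proof.
move=> mf f0 fi.
have g0 m t : (0 <= \sum_(j <oo) f m j t)%E by apply: nneseries_ge0.
have : {ae mu, forall t, (\sum_(m <oo) \sum_(j <oo) f m j t)%E \is a fin_num}.
  apply: ge0_integral_lty_ae.
  - by apply: measurable_eseries => m; exact: measurable_eseries.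
  - by move=> t; apply: nneseries_ge0.
  rewrite integral_nneseries//; last by move=> m; exact: measurable_eseries.
  by under eq_eseriesr do rewrite integral_nneseries//.
apply: filterS => t tfin; exists (fine (\sum_(m <oo) \sum_(j <oo) f m j t)%E) => m j.
rewrite fineK//.
apply: (@le_trans _ _ (\sum_(j <oo) f m j t)%E).
  exact: (nneseries_ge_term (fun j => f m j t)).
exact: (nneseries_ge_term (fun m => (\sum_(j <oo) f m j t)%E)).
Qed.

Lemma sum_inv_consecutive {R : realType} n :
  \sum_(0 <= j < n) ((j.+1 * j.+2)%:R^-1 : R) = 1 - n.+1%:R^-1.
Proof.
elim: n => [|n IH]; first by rewrite big_nil invr1 subrr.
rewrite big_nat_recr//= IH natrM.
have h1 : (n.+1%:R : R) != 0 by rewrite pnatr_eq0.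
have h2 : (n.+2%:R : R) != 0 by rewrite pnatr_eq0.
rewrite -(natr1 n.+1) in h2 *.
by move: (n.+1%:R : R) h1 h2 => x h1 h2; field; rewrite ?h1 ?h2.
Qed.

Section rate.
Context {R : realType} {d0 d} {T0 : measurableType d0} {T : measurableType d}.
Context {P0 : probability T0 R} {p : nat -> {RV P0 >-> R}}.
Context {P : probability T R} {V : node -> nat -> {RV P >-> R}}.
Context {C : nat -> node -> {RV P >-> nat}}.
Hypotheses (V_iid : iid_copies P0 p P V) (C_given : choices_given P V C).
Variables a b : R.
Hypothesis aE : (\int[P0]_t \sum_(i <oo) (p i t ^+ 2)%:E = a%:E)%E.
Hypotheses (a0 : 0 <= a) (ab : a < b).

Lemma measurable_coincidences m n :
  measurable_fun setT (fun t => (coincidences (C := C) m n t)%:R : R).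
Proof.
rewrite (_ : (fun _ => _) = fun t => \sum_(k < n) \sum_(l < n)
    (if k != l then (coincide (C := C) m k l t)%:R else 0 : R)).
  apply: measurable_sum => k; apply: measurable_sum => l.
  by have [kl|kl] := boolP (k != l); [exact: measurable_coincide|exact: measurable_cst].
apply/funext => t; rewrite /coincidences natr_sum; apply: eq_bigr => k _.
by rewrite natr_sum big_mkcond.
Qed.

(* The weights b^m (j+1)^12 * (j+1) (j+2) make the bounds 4 (j+1)^12 a^m on
   the variances summable over m and j. *)
Lemma ae_coincidences_rate :
  {ae P, forall t, exists r : R, forall m j, let n := (j.+1 ^ 4)%N in
    ((coincidences (C := C) m n t)%:R - (n * n.-1)%:R * qlevel (V := V) m t) ^+ 2
      <= r * b ^+ m * (j.+1 ^ 13 * j.+2)%:R}.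
Proof.
have b0 : 0 < b by exact: le_lt_trans ab.
pose n j := (j.+1 ^ 4)%N.
pose w m j : R := b ^+ m * (j.+1 ^ 13 * j.+2)%:R.
have w0 m j : 0 < w m j.
  by rewrite mulr_gt0 ?exprn_gt0// ltr0n muln_gt0 expn_gt0.
pose f m j t := (((coincidences (C := C) m (n j) t)%:R -
  (n j * (n j).-1)%:R * qlevel (V := V) m t) ^+ 2 / w m j)%:E.
have mX m j : measurable_fun setT (fun t => ((coincidences (C := C) m (n j) t)%:R -
  (n j * (n j).-1)%:R * qlevel (V := V) m t) ^+ 2).
  apply: measurable_funX; apply: measurable_funB.
    exact: measurable_coincidences.
  by apply: measurable_funM => //; exact: measurable_qlevel.
have mf m j : measurable_fun setT (f m j).
  by apply/measurable_EFinP; exact: measurable_funM.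
have f0 m j t : (0 <= f m j t)%E.
  by rewrite lee_fin mulr_ge0 ?sqr_ge0// invr_ge0 ltW.
have intf m j : (\int[P]_t f m j t <=
    (4 * (a / b) ^+ m)%:E * ((j.+1 * j.+2)%:R^-1)%:E)%E.
  rewrite /f; under eq_integral do rewrite mulrC EFinM.
  rewrite ge0_integralZl//; last 3 first.
  - exact/measurable_EFinP.
  - by move=> t _; rewrite lee_fin sqr_ge0.
  - by rewrite lee_fin invr_ge0 ltW.
  apply: (@le_trans _ _ ((w m j)^-1%:E * ((4 * (n j) ^ 3)%:R * a ^+ m)%:E)%E).
    apply: lee_wpmul2l; first by rewrite lee_fin invr_ge0 ltW.
    exact: (variance_coincidences V_iid C_given a aE).
  rewrite -!EFinM lee_fin le_eqVlt; apply/orP; left; apply/eqP.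
  have e1 : (j.+1 ^ 13 * j.+2)%:R = j.+1%:R ^+ 13 * j.+2%:R :> R.
    by rewrite natrM natrX.
  have e2 : (4 * (j.+1 ^ 4) ^ 3)%:R = 4 * j.+1%:R ^+ 12 :> R.
    by rewrite natrM -expnM natrX.
  have e3 : (j.+1 * j.+2)%:R = j.+1%:R * j.+2%:R :> R by rewrite natrM.
  rewrite /w /n e1 e2 e3 exprMn exprVn.
  have j0 : (j.+1%:R : R) != 0 by rewrite pnatr_eq0.
  have j1 : (j.+2%:R : R) != 0 by rewrite pnatr_eq0.
  have bm : b ^+ m != 0 by rewrite expf_neq0// gt_eqF.
  move: (j.+1%:R : R) (j.+2%:R : R) (a ^+ m) (b ^+ m) j0 j1 bm => x y u v x0 y0 v0.
  by field; rewrite x0 y0 v0.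
have abge0 : 0 <= a / b by rewrite divr_ge0// ltW.
have : {ae P, forall t, exists r : R, forall m j, (f m j t <= r%:E)%E}.
  apply: ae_double_series_bounded => //.
  (* The sum over [j] telescopes to at most 1; the sum over [m] is geometric with ratio
     [a / b < 1]. *)
  apply: (@le_lt_trans _ _ (\sum_(m <oo) (4 * (a / b) ^+ m)%:E)%E).
    apply: lee_nneseries => [m _ _|m _].
      by apply: nneseries_ge0 => j _ _; apply: integral_ge0.
    apply: (@le_trans _ _ (\sum_(j <oo) (4 * (a / b) ^+ m)%:E * ((j.+1 * j.+2)%:R^-1)%:E)%E).
      by apply: lee_nneseries => [j _ _|j _]; [exact: integral_ge0|exact: intf].
    rewrite nneseriesZl; last by move=> j _; rewrite lee_fin.
    rewrite -[leRHS]mule1 lee_wpmul2l ?lee_fin ?mulr_ge0 ?exprn_ge0//.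
    apply: lime_le; first by apply: is_cvg_nneseries => j _ _; rewrite lee_fin.
    by apply: nearW => k; rewrite sumEFin sum_inv_consecutive lee_fin gerBl.
  rewrite (_ : (\sum_(m <oo) _)%E = (4 * (1 - a / b)^-1)%:E) ?ltry//.
  apply/cvg_lim => //.
  rewrite (_ : (fun _ => _) = EFin \o series (geometric 4 (a / b))); last first.
    by apply/funext => k /=; rewrite /series/= -sumEFin.
  apply/cvg_EFin => //; first by apply: nearW.
  by apply: cvg_geometric_series; rewrite ger0_norm// ltr_pdivrMr// mul1r.
apply: filterS => t [r fr]; exists r => m j /=.
by have := fr m j; rewrite lee_fin ler_pdivrMr// mulrA.
Qed.

End rate.

(** * Positions of the balls *)

Section ball_positions.
Variable c : nat -> node -> nat.

Definition position (k : nat) : node :=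
  let S := split_tree c k in descend S (c k) #|` S| [::].

Lemma split_treeS n : split_tree c n.+1 = (position n |` split_tree c n)%fset.
Proof. by []. Qed.

Lemma position_notin k : position k \notin split_tree c k.
Proof. exact: descend_notin. Qed.

Lemma card_split_tree n : #|` split_tree c n| = n.
Proof. by elim: n => [|n IH]; rewrite ?cardfs0// split_treeS cardfsU1 position_notin IH. Qed.

(** A descending ball stays on its own ray, wherever it stops; the bound on [i] also bounds its
    depth. *)
Lemma descend_ray (S : {fset node}) (f : node -> nat) k j :
  exists2 i, (i <= j + k)%N & descend S f k (ray f j) = ray f i.
Proof.
elim: k j => [|k IH] j /=; first by exists j; rewrite ?addn0.
case: ifPn => _; last by exists j; rewrite ?leq_addr.
by have [i ij E] := IH j.+1; exists i; rewrite ?addnS -?addSn.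
Qed.

Lemma position_ray k : position k = ray (c k) (size (position k)).
Proof.
have [i _ E] := descend_ray (split_tree c k) (c k) #|` split_tree c k| 0.
by rewrite /position/= [descend _ _ _ _]E size_ray.
Qed.

Lemma size_position k : (size (position k) <= k)%N.
Proof.
have [i ik E] := descend_ray (split_tree c k) (c k) #|` split_tree c k| 0.
by rewrite /position/= [descend _ _ _ _]E size_ray; move: ik; rewrite card_split_tree.
Qed.

Lemma position_in k n : (k < n)%N -> position k \in split_tree c n.
Proof.
elim: n => // n IH; rewrite ltnS leq_eqVlt => /orP[/eqP ->|/IH kn] /=.
  by rewrite fset1U1.
by rewrite fset1Ur.
Qed.

Lemma position_neq k l : (k < l)%N -> position k <> position l.
Proof.
move=> kl E; have /negP := position_notin l; apply.
by rewrite -E; exact: position_in.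
Qed.

Lemma position_inj : injective position.
Proof.
move=> k l E; have [kl|lk|//] := ltngtP k l.
  by have := position_neq k l kl E.
by have := position_neq l k lk (esym E).
Qed.

Lemma sum_split_tree (F : node -> nat) n :
  (\sum_(v <- split_tree c n) F v = \sum_(k < n) F (position k))%N.
Proof.
elim: n => [|n IH]; first by rewrite big_ord0 big_seq_fset0.
by rewrite split_treeS big_fsetU1 ?position_notin//= IH big_ord_recr addnC.
Qed.

Lemma leq_size_lca m v w :
  (m <= size (lca v w))%N = [&& (m <= size v)%N, (m <= size w)%N & take m v == take m w].
Proof.
elim: v w m => [|i v IH] [|j w] [|m] //=; rewrite ?andbF//.
case: eqVneq => [->|ij] /=; first by rewrite !ltnS IH eqseq_cons eqxx.
by rewrite eqseq_cons (negbTE ij) !andbF.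
Qed.

Definition deep_pairs (m n : nat) : nat :=
  (\sum_(k < n) \sum_(l < n | k != l) (m <= size (lca (position k) (position l))))%N.

(** A depth is the number of levels [m >= 1] not exceeding it. Levels up to [n] suffice, since ball
    [k < n] has depth at most [k]. *)
Lemma Y_split_tree n :
  Y (split_tree c n) = (\sum_(1 <= m < n.+1) deep_pairs m n)%N.
Proof.
rewrite /Y sum_split_tree.
rewrite [RHS]exchange_big/=; apply: eq_bigr => k _.
rewrite [RHS]exchange_big/= [RHS]big_mkcond/= big_mkcond/= sum_split_tree.
apply: eq_bigr => l _.
rewrite (inj_eq position_inj); case: ifP => // kl.
rewrite /depth; set s := size _.
have sn : (s <= n)%N.
  have : (s <= s)%N by []. rewrite leq_size_lca => /and3P[sk _ _].
  by apply: leq_trans sk (leq_trans (size_position k) (ltnW (ltn_ord k))).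
rewrite (big_cat_nat (n := s.+1))//=.
rewrite (@eq_big_nat _ _ _ 1 s.+1 _ (fun=> 1%N)); last first.
  by move=> i /andP[_]; rewrite ltnS => ->.
rewrite sum_nat_const_nat muln1 subn1 /= big_nat big1 ?addn0//.
by move=> i /andP[si _]; rewrite leqNgt si.
Qed.

(** The pathwise form of [coincidences], for a fixed outcome of the choices. *)
Definition ray_pairs (m n : nat) : nat :=
  (\sum_(k < n) \sum_(l < n | k != l) (ray (c k) m == ray (c l) m))%N.

Lemma take_position m k : (m <= size (position k))%N ->
  take m (position k) = ray (c k) m.
Proof. by move=> mk; rewrite position_ray take_ray. Qed.

Lemma deep_pairs_le m n : (deep_pairs m n <= ray_pairs m n)%N.
Proof.
apply: leq_sum => k _; apply: leq_sum => l _; rewrite leq_size_lca.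
have [mk|mk] := leqP m (size (position k)); last by [].
have [ml|ml] := leqP m (size (position l)); last by [].
by rewrite !take_position.
Qed.

(* Distinct balls that stop before depth m on the same path stop at different
   depths, so at most m balls do. *)
Lemma card_shallow m n (u : node) :
  (\sum_(k < n) ((size (position k) < m)%N && (ray (c k) m == u)) <= m)%N.
Proof.
pose A := [pred k : 'I_n | (size (position k) < m)%N && (ray (c k) m == u)].
rewrite [leqLHS](_ : _ = #|A|); last by rewrite -big_mkcond/= sum1_card.
have <- : size [seq size (position k) | k : 'I_n <- enum A] = #|A|.
  by rewrite size_map -cardE.
rewrite -[leqRHS](size_iota 0); apply: uniq_leq_size.
  rewrite map_inj_in_uniq ?enum_uniq// => k l; rewrite !mem_enum !inE.
  move=> /andP[km /eqP ku] /andP[lm /eqP lu] kl; apply/val_inj/position_inj.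
  have E (j : nat) : (size (position j) < m)%N -> ray (c j) m = u ->
      position j = take (size (position j)) u.
    move=> jm <-; rewrite take_ray; first exact: position_ray.
    exact: ltnW.
  exact: etrans (E k km ku) (etrans (congr1 (take^~ u) kl) (esym (E l lm lu))).
move=> j /mapP[k]; rewrite mem_enum inE mem_iota => /andP[km _] ->.
by rewrite add0n.
Qed.

(** If the rays agree up to level [m] but the common ancestor is shallower, one of the two balls
    stopped before level [m]. For each partner, [card_shallow] allows at most [m] such balls. *)
Lemma ray_pairs_le m n : (ray_pairs m n <= deep_pairs m n + 2 * (m * n))%N.
Proof.
pose g (k l : nat) : nat := (size (position k) < m)%N && (ray (c k) m == ray (c l) m).
have gn : (\sum_(l < n) \sum_(k < n) g k l <= m * n)%N.
  rewrite mulnC -[n in (n * m)%N]card_ord -sum_nat_const.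
  by apply: leq_sum => l _; exact: card_shallow.
have step (k l : nat) : (ray (c k) m == ray (c l) m <=
   (m <= size (lca (position k) (position l))) + (g k l + g l k))%N.
  rewrite leq_size_lca /g [ray (c l) m == _]eq_sym.
  have [km|km] := leqP m (size (position k)); have [lm|lm] := leqP m (size (position l)).
  - by rewrite !take_position// leq_addr.
  - by rewrite leq_addl.
  - by rewrite addn0 leq_addl.
  - by rewrite addnA leq_addl.
apply: (@leq_trans (\sum_(k < n) \sum_(l < n | k != l)
   ((m <= size (lca (position k) (position l))) + (g k l + g l k)))).
  by apply: leq_sum => k _; apply: leq_sum => l _; exact: step.
apply: (@leq_trans (deep_pairs m n + (\sum_(k < n) \sum_(l < n) g k l
    + \sum_(k < n) \sum_(l < n) g l k))).
  rewrite /deep_pairs -!big_split/=; apply: leq_sum => k _.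
  rewrite big_split leq_add2l -big_split/=.
  by rewrite [leqRHS](bigID (fun l => k != l))/= leq_addr.
rewrite leq_add2l mulSn mul1n; apply: leq_add; last exact: gn.
by rewrite exchange_big; exact: gn.
Qed.

Lemma ray_pairs_mono m n n' : (n <= n')%N -> (ray_pairs m n <= ray_pairs m n')%N.
Proof.
move=> nn'.
have E N : ray_pairs m N = (\sum_(0 <= k < N) \sum_(0 <= l < N | k != l)
    (ray (c k) m == ray (c l) m))%N.
  by rewrite big_mkord; apply: eq_bigr => k _; rewrite big_mkord.
rewrite !E (big_cat_nat (n := n) (p := n'))//=; apply: leq_trans (leq_addr _ _).
apply: leq_sum => k _; rewrite [leqRHS](big_cat_nat (n := n))//=.
exact: leq_addr.
Qed.

End ball_positions.

(** * Interpolation between fourth powers *)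

Lemma fourth_root_exists n : exists j, (j ^ 4 <= n < j.+1 ^ 4)%N.
Proof.
elim: n => [|n [j /andP[jn nj]]]; first by exists 0%N.
have [h|h] := leqP (j.+1 ^ 4) n.+1; last by exists j; rewrite h andbT leqW.
exists j.+1; rewrite h /=; apply: (leq_trans (n := j.+1 ^ 4 + 1)); first by rewrite addn1 ltnS.
by rewrite addn1 ltn_exp2r.
Qed.

Lemma sqr_le_norm {R : rcfType} (x y : R) : 0 <= y -> x ^+ 2 <= y ^+ 2 -> `|x| <= y.
Proof.
by move=> y0; rewrite -[x ^+ 2]real_normK ?num_real// ler_pXn2r ?nnegrE.
Qed.

Section interpolation.
Context {R : realType} (z : nat -> nat) (q D : R).
Hypotheses (q0 : 0 <= q) (D0 : 0 <= D).
Hypothesis z_mono : forall n n', (n <= n')%N -> (z n <= z n')%N.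
Hypothesis z_rate : forall j,
  `|(z (j.+1 ^ 4))%:R - (j.+1 ^ 4 * (j.+1 ^ 4).-1)%:R * q| <= D * j.+1%:R ^+ 7.

(** The difference of eighth powers factors into 8 terms, each at most [(2 * X) ^+ 7], and 8 times
    128 is 1024. *)
Lemma subrX8_le (X : R) : 1 <= X -> (X + 1) ^+ 8 <= X ^+ 8 + 1024 * X ^+ 7.
Proof.
move=> X1; have X0 : 0 <= X by exact: le_trans X1.
rewrite -lerBlDl subrXX addrAC subrr add0r mul1r.
have h i : (i < 8)%N -> (X + 1) ^+ (8.-1 - i) * X ^+ i <= (2 * X) ^+ 7.
  move=> i8; have -> : (2 * X) ^+ 7 = (2 * X) ^+ (8.-1 - i) * (2 * X) ^+ i.
    by rewrite -exprD subnK.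
  rewrite ler_pM ?exprn_ge0//; try by rewrite addr_ge0.
    by rewrite lerXn2r// ?nnegrE; lra.
  by rewrite lerXn2r// ?nnegrE; lra.
apply: (@le_trans _ _ (\sum_(i < 8) (2 * X) ^+ 7)); first by apply: ler_sum => i _; exact: h.
by rewrite sumr_const card_ord exprMn -mulr_natl; lra.
Qed.

(** By monotonicity [z n] lies between its values at the neighbouring fourth powers, whose squares
    differ by [O(J^7)], that is [O(n^2 / J)]. The 1025 is 1024 from [subrX8_le] plus 1 for the
    [X ^+ 4 * q] in which [n (n - 1) q] differs from [n^2 q]. *)
Lemma interpolation J n : (0 < J)%N -> (J ^ 4 <= n < J.+1 ^ 4)%N ->
  `|(z n)%:R - n%:R ^+ 2 * q| <= 1025 * (q + D) * n%:R ^+ 2 / J%:R.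
Proof.
(* The index is shifted to match [z_rate]: from here [X] is the [J] of the statement, and the upper
   neighbour is [J.+2 ^ 4]. *)
case: J => // J _ /andP[Jn nJ]; set X : R := J.+1%:R; set N : R := n%:R.
have X1 : 1 <= X by rewrite ler1n.
have X0 : 0 <= X by exact: le_trans X1.
have XN : X ^+ 4 <= N by rewrite -natrX ler_nat.
have NX : N <= (X + 1) ^+ 4 by rewrite /X natr1 -natrX ler_nat ltnW.
have N0 : 0 <= N by [].
have XN2 : X ^+ 8 <= N ^+ 2.
  by rewrite (exprM X 4 2) lerXn2r// nnegrE// exprn_ge0.
have NX2 : N ^+ 2 <= (X + 1) ^+ 8.
  by rewrite (exprM (X + 1) 4 2) lerXn2r// nnegrE// exprn_ge0// addr_ge0.
have X8 := subrX8_le X X1.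
have X47 : X ^+ 4 <= X ^+ 7 by rewrite ler_weXn2l.
have X7_0 : 0 <= X ^+ 7 by rewrite exprn_ge0.
have X17 : (X + 1) ^+ 7 <= 128 * X ^+ 7.
  have -> : 128 * X ^+ 7 = (2 * X) ^+ 7 by rewrite exprMn; congr (_ * _); ring.
  by rewrite lerXn2r// ?nnegrE; lra.
have up : (z n)%:R <= (X + 1) ^+ 8 * q + D * (X + 1) ^+ 7.
  have zn : ((z n)%:R : R) <= (z (J.+2 ^ 4))%:R by rewrite ler_nat z_mono// ltnW.
  apply: (le_trans zn); have := z_rate J.+1; rewrite ler_norml => /andP[_].
  rewrite -[J.+2%:R]natr1 -/X lerBlDl => /le_trans; apply; rewrite lerD2r.
  apply: ler_wpM2r => //; rewrite /X natr1 -natrX ler_nat.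
  by rewrite (_ : 8 = 4 + 4)%N// expnD leq_mul2l leq_pred orbT.
have lo : X ^+ 8 * q - X ^+ 4 * q - D * X ^+ 7 <= (z n)%:R.
  have zn : ((z (J.+1 ^ 4))%:R : R) <= (z n)%:R by rewrite ler_nat z_mono.
  apply: le_trans zn; have := z_rate J; rewrite ler_norml => /andP[+ _].
  have -> : ((J.+1 ^ 4 * (J.+1 ^ 4).-1)%:R : R) = X ^+ 8 - X ^+ 4.
    rewrite natrM -subn1 natrB ?expn_gt0// natrX -/X mulrBr mulr1.
    by rewrite -exprD.
  by rewrite -/X -mulrBl lerBrDr addrC.
have XN2' : X ^+ 7 <= N ^+ 2 / X.
  rewrite ler_pdivlMr; last exact: lt_le_trans X1.
  by rewrite -exprSr.
have qD0 : 0 <= q + D by rewrite addr_ge0.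
have key (K : R) : 0 <= K -> K * X ^+ 7 <= K * N ^+ 2 / X.
  by move=> K0; rewrite -[leRHS]mulrA ler_wpM2l.
apply: le_trans (key (1025 * (q + D)) _); last first.
  by apply: mulr_ge0; [exact: ler0n|exact: qD0].
move: ((z n)%:R : R) up lo => zn up lo; clearbody X N.
have q8 : X ^+ 8 * q <= N ^+ 2 * q by rewrite ler_wpM2r.
have q8' : N ^+ 2 * q <= X ^+ 8 * q + 1024 * (X ^+ 7 * q).
  by rewrite mulrA -mulrDl ler_wpM2r//; exact: le_trans X8.
have q8'' : (X + 1) ^+ 8 * q <= X ^+ 8 * q + 1024 * (X ^+ 7 * q).
  by rewrite mulrA -mulrDl ler_wpM2r.
have D7 : D * (X + 1) ^+ 7 <= 128 * (D * X ^+ 7) by rewrite [leRHS]mulrCA ler_wpM2l.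
have q47 : X ^+ 4 * q <= X ^+ 7 * q by rewrite ler_wpM2r.
have Dp : 0 <= D * X ^+ 7 by rewrite mulr_ge0.
have qp : 0 <= X ^+ 7 * q by rewrite mulr_ge0.
have -> : 1025 * (q + D) * X ^+ 7 = 1025 * (X ^+ 7 * q) + 1025 * (D * X ^+ 7).
  by rewrite -mulrDr -mulrA [(q + D) * _]mulrDl [q * _]mulrC.
move: (X ^+ 8 * q) (X ^+ 7 * q) (X ^+ 4 * q) (D * X ^+ 7) (N ^+ 2 * q)
  ((X + 1) ^+ 8 * q) (D * (X + 1) ^+ 7) up lo q8 q8' q8'' D7 q47 Dp qp.
clear => a8 a7 a4 d7 n2 e8 f7 *.
rewrite ler_norml; apply/andP; split; lra.
Qed.

End interpolation.

(** * Summation over the levels *)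

Section scaled_sums.
Context {R : realType} (y z : nat -> nat -> nat) (q : nat -> R) (Q b r : R).
Hypotheses (b01 : 0 < b < 1) (q0 : forall m, 0 <= q m).
Hypothesis z_mono : forall m n n', (n <= n')%N -> (z m n <= z m n')%N.
Hypothesis z_rate : forall m j,
  ((z m (j.+1 ^ 4))%:R - (j.+1 ^ 4 * (j.+1 ^ 4).-1)%:R * q m) ^+ 2
    <= r * b ^+ m * (j.+1 ^ 13 * j.+2)%:R.
Hypothesis yz : forall m n, (y m n <= z m n)%N.
Hypothesis zy : forall m n, (z m n <= y m n + 2 * (m * n))%N.
Hypothesis q_sum : \sum_(1 <= m < k) q m @[k --> \oo] --> Q.

(** Square roots are taken in [z_rate]: [D m] is the resulting constant for level [m], summable as
    [beta < 1]; its factor 2 comes from [j.+2 <= 2 * j.+1]. *)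
Let beta := Num.sqrt b.
Let D m := Num.sqrt (2 * r) * beta ^+ m.

Let r0 : 0 <= r.
Proof.
have := z_rate 0 0; rewrite expr0 mulr1 exp1n mul1n /= => h.
have := le_trans (sqr_ge0 _) h; lra.
Qed.

Let beta01 : 0 <= beta < 1.
Proof.
case/andP: b01 => b0 b1; rewrite sqrtr_ge0 /= -[ltRHS]sqrtr1.
by rewrite ltr_sqrt.
Qed.

Let D0 m : 0 <= D m.
Proof. by rewrite mulr_ge0 ?sqrtr_ge0// exprn_ge0// sqrtr_ge0. Qed.

Let z_rate_norm m j :
  `|(z m (j.+1 ^ 4))%:R - (j.+1 ^ 4 * (j.+1 ^ 4).-1)%:R * q m| <= D m * j.+1%:R ^+ 7.
Proof.
apply: sqr_le_norm; first by rewrite mulr_ge0// exprn_ge0.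
apply: le_trans (z_rate m j) _.
have b0 : 0 <= b by case/andP: b01 => /ltW.
have -> : (D m * j.+1%:R ^+ 7) ^+ 2 = r * b ^+ m * (j.+1%:R ^+ 13 * (2 * j.+1%:R)).
  rewrite /D; set x : R := j.+1%:R.
  have e1 : Num.sqrt (2 * r) ^+ 2 = 2 * r by rewrite sqr_sqrtr// mulr_ge0.
  have e2 : (beta ^+ m) ^+ 2 = b ^+ m by rewrite -exprM mulnC exprM sqr_sqrtr.
  rewrite !exprMn e1 e2; ring.
apply: ler_wpM2l; first by rewrite mulr_ge0// exprn_ge0.
have j2 : (j.+2 <= 2 * j.+1)%N by lia.
rewrite natrM natrX ler_wpM2l// -natrM ler_nat//.
Qed.

(** For the upper bound [y <= z] on all levels and the errors are summable in [m]. For the lower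
    bound only levels up to the fourth root [J n] are kept, where passing from [z] to [y] is
    cheap. *)
Lemma scaled_sum_cvg :
  (\sum_(1 <= m < n.+1) y m n)%:R / n%:R ^+ 2 @[n --> \oo] --> Q.
Proof.
have aux (j k : nat) : (j * j * j <= k -> j * (2 * (j * k)) * j <= 2 * k ^ 2)%N.
  by clear; rewrite expnS expn1; nia.
have [J JP] := choice fourth_root_exists.
have Jy : J n @[n --> \oo] --> \oo.
  apply/cvgnyPge => A; near=> n.
  have An : (A ^ 4 <= n)%N by near: n; exact: nbhs_infty_ge.
  have /andP[_ nJ] := JP n; rewrite -ltnS -(ltn_exp2r _ _ (_ : 0 < 4)%N)//.
  exact: leq_ltn_trans nJ.
have JV : (J n)%:R^-1 @[n --> \oo] --> (0 : R).
  apply/cvgrPdist_le => e e0; near=> n.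
  rewrite sub0r normrN ger0_norm// invf_ple ?posrE//; last first.
    by rewrite ltr0n; near: n; exact: (proj1 (cvgnyPge _) Jy 1%N).
  apply: le_trans (ltW (archi_boundP _)) _; first by rewrite invr_ge0 ltW.
  by rewrite ler_nat; near: n; exact: (proj1 (cvgnyPge _) Jy).
have [K [K0 interp]] : exists K : R, 0 <= K /\ forall m n, (0 < J n)%N ->
    `|(z m n)%:R - n%:R ^+ 2 * q m| <= K * (q m + D m) * n%:R ^+ 2 / (J n)%:R.
  exists 1025; split; first exact: ler0n.
  move=> m n Jn0.
  exact: (interpolation (z m) (q m) (D m) (q0 m) (D0 m) (z_mono m)
    (z_rate_norm m) (J n) n Jn0 (JP n)).
have q_nd : nondecreasing_seq (fun k => \sum_(1 <= m < k) q m).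
  move=> k k' kk'; have [k1|k1] := leqP 1 k.
    by rewrite [leRHS](big_cat_nat (n := k))//= lerDl sumr_ge0.
  by rewrite big_geq ?sumr_ge0// ltnW.
have q_le k : \sum_(1 <= m < k) q m <= Q.
  have := nondecreasing_cvgn_le q_nd (cvgP _ q_sum) k.
  by rewrite (cvg_lim _ q_sum).
have Q0 : 0 <= Q by apply: le_trans (q_le 0%N); rewrite big_geq.
(* A bound on the sum of all [q m + D m]: the limit [Q] plus a geometric series. *)
pose B := Q + Num.sqrt (2 * r) / (1 - beta).
have sB k : \sum_(1 <= m < k) (q m + D m) <= B.
  rewrite big_split lerD//= /D -mulr_sumr ler_wpM2l ?sqrtr_ge0//.
  have [b0 b1] := andP beta01.
  have [k1|k1] := leqP k 1; first by rewrite big_geq// invr_ge0 subr_ge0 ltW.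
  apply: (@le_trans _ _ (series (geometric 1 beta) k)).
    rewrite /series/= [leRHS](big_cat_nat (n := 1))//=; last exact: ltnW.
    rewrite (eq_bigr (fun i => 1 * beta ^+ i)); last by move=> i _; rewrite mul1r.
    by rewrite lerDr sumr_ge0// => i _; rewrite mul1r exprn_ge0.
  rewrite geometric_seriesE ?lt_eqF//= mul1r ler_pdivrMr ?subr_gt0//.
  by rewrite mulVf ?gt_eqF ?subr_gt0// gerBl exprn_ge0.
have B0 : 0 <= B by apply: le_trans (sB 0%N); rewrite big_geq.
have bound : \forall n \near \oo,
    \sum_(1 <= m < (J n).+1) q m - (K * B + 2) / (J n)%:R <=
    (\sum_(1 <= m < n.+1) y m n)%:R / n%:R ^+ 2 <=
    Q + K * B / (J n)%:R.
  near=> n.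
  have J0 : (0 < J n)%N.
    near: n; exact: (proj1 (cvgnyPge _) Jy 1%N).
  have n0 : (0 < n)%N by near: n; exact: nbhs_infty_ge.
  have /andP[Jn nJ] := JP n.
  have N0 : 0 < (n%:R : R) ^+ 2 by rewrite exprn_gt0// ltr0n.
  have X0 : 0 < ((J n)%:R : R) by rewrite ltr0n.
  have key m : `|(z m n)%:R - n%:R ^+ 2 * q m| <=
      K * (q m + D m) * n%:R ^+ 2 / (J n)%:R.
    exact: interp.
  have sK k : \sum_(1 <= m < k) (K * (q m + D m) * n%:R ^+ 2 / (J n)%:R)
      <= K * B / (J n)%:R * n%:R ^+ 2.
    rewrite (eq_bigr (fun m => (K / (J n)%:R * n%:R ^+ 2) * (q m + D m))); last first.
      by move=> m _; ring.
    rewrite -mulr_sumr.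
    rewrite (_ : K * B / (J n)%:R * n%:R ^+ 2 = (K / (J n)%:R * n%:R ^+ 2) * B); last ring.
    by rewrite ler_wpM2l// mulr_ge0// ?divr_ge0// ltW.
  apply/andP; split; last first.
    rewrite ler_pdivrMr// mulrDl.
    apply: (@le_trans _ _ (\sum_(1 <= m < n.+1) (n%:R ^+ 2 * q m +
       K * (q m + D m) * n%:R ^+ 2 / (J n)%:R))).
      rewrite natr_sum; apply: ler_sum => m _.
      apply: (@le_trans _ _ (z m n)%:R); first by rewrite ler_nat.
      by have := key m; rewrite ler_norml => /andP[_]; lra.
    rewrite big_split/= lerD// -mulr_sumr mulrC ler_wpM2r// ltW//.
  rewrite ler_pdivlMr// mulrBl.
  apply: (@le_trans _ _ (\sum_(1 <= m < (J n).+1) ((n%:R ^+ 2 * q m -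
       K * (q m + D m) * n%:R ^+ 2 / (J n)%:R) - (2 * (m * n))%:R))).
    rewrite !big_split/= !sumrN -mulr_sumr.
    have h1 := sK (J n).+1.
    (* Each of the [J] levels costs at most [2 J n], and [J^3 <= n] makes the total at most
       [2 n^2 / J]. *)
    have h2 : \sum_(1 <= m < (J n).+1) ((2 * (m * n))%:R : R) <= 2 / (J n)%:R * n%:R ^+ 2.
      rewrite -natr_sum mulrAC ler_pdivlMr// -!natrX -!natrM ler_nat.
      apply: (@leq_trans ((J n * (2 * (J n * n))) * J n)).
        rewrite leq_mul2r; apply/orP; right.
        rewrite big_add1/= big_mkord -[X in (_ <= X * _)%N](card_ord (J n)) -sum_nat_const.
        by apply: leq_sum => i _; rewrite leq_mul2l/= leq_mul2r ltn_ord orbT.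
      have : (J n * J n * J n <= n)%N.
        apply: leq_trans Jn; rewrite !expnS expn0 muln1 !mulnA leq_pmulr//.
      exact: aux.
    have -> : (K * B + 2) / (J n)%:R * n%:R ^+ 2 =
       K * B / (J n)%:R * n%:R ^+ 2 + 2 / (J n)%:R * n%:R ^+ 2 by ring.
    rewrite opprD addrA; apply: lerB h2; apply: lerB h1.
    by rewrite mulrC.
  have Jln : (J n <= n)%N by apply: leq_trans Jn; rewrite -[leqLHS]expn1 leq_pexp2l.
  rewrite natr_sum [leRHS](big_cat_nat (n := (J n).+1))//= -[leLHS]addr0 lerD ?sumr_ge0//.
  apply: ler_sum => m _.
  have := key m; rewrite ler_norml => /andP[+ _].
  have h : ((z m n)%:R : R) <= (y m n)%:R + (2 * (m * n))%:R by rewrite -natrD ler_nat.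
  rewrite lerBrDl => /le_trans/(_ h) h'.
  by rewrite lerBlDr.
apply: (squeeze_cvgr bound).
- rewrite -[X in _ --> X]subr0 -[in X in _ - X](mulr0 (K * B + 2)).
  apply: cvgB; last exact: cvgMr.
  have Jy1 : (J n).+1 @[n --> \oo] --> \oo.
    apply/cvgnyPge => A; near=> n; apply: leqW; near: n.
    exact: (proj1 (cvgnyPge _) Jy A).
  exact: (cvg_comp _ _ Jy1 q_sum).
- rewrite -[X in _ --> X]addr0 -[in X in _ + X](mulr0 (K * B)).
  by apply: cvgD; [exact: cvg_cst|exact: cvgMr].
Unshelve. all: by end_near. Qed.

End scaled_sums.

(** * The limit *)

Lemma ae_eq_measure {R : realType} {d} {T : measurableType d}
    (mu : {measure set T -> \bar R}) (A B : set T) :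
  measurable A -> measurable B -> {ae mu, forall t, A t <-> B t} -> mu A = mu B.
Proof.
move=> mA mB AB; rewrite -[A in LHS]setIT -[B in RHS]setIT.
rewrite -!integral_indic//; apply: ge0_ae_eq_integral => //.
- by apply/measurable_EFinP; exact: measurable_indic.
- by apply/measurable_EFinP; exact: measurable_indic.
apply: filterS AB => t tAB _; rewrite !indicE; congr ((nat_of_bool _)%:R%:E).
by apply/idP/idP => /set_mem ?; apply/mem_set; apply/tAB.
Qed.

Lemma ae_same_law {R : realType} {d1 d2 d'} {T1 : measurableType d1}
    {T2 : measurableType d2} {E : measurableType d'}
    (P1 : probability T1 R) (P2 : probability T2 R)
    (X1 : T1 -> E) (X2 : T2 -> E) (B : set E) :
  measurable_fun setT X1 -> measurable_fun setT X2 ->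
  (forall B, measurable B -> P1 (X1 @^-1` B) = P2 (X2 @^-1` B)) ->
  measurable B -> {ae P1, forall t, B (X1 t)} -> {ae P2, forall t, B (X2 t)}.
Proof.
move=> mX1 mX2 X12 mB BX1.
have mpre d (T : measurableType d) (X : T -> E) A : measurable_fun setT X ->
  measurable A -> measurable (X @^-1` A).
  by move=> mX mA; rewrite -[X in measurable X]setTI; exact: mX.
exists (X2 @^-1` ~` B); split => //.
- by apply: mpre => //; exact: measurableC.
- rewrite -X12; last exact: measurableC.
  apply/negligibleP; first by apply: mpre => //; exact: measurableC.
  by move: BX1 => [N [mN N0 BN]]; exists N; split.
Qed.

(** * Joint law of the input of the fixed point equation *)

Section inputs.
Context {R : realType}.
(** Left indices carry the entries of the vector, right indices the copies of [Q]. *)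
Definition input_env := env (R := R) (nat + nat).

Definition join_input {T : Type} (p Q : nat -> T -> R) (t : T) : input_env :=
  fun s => match s with inl j => p j t | inr i => Q i t end.

Definition input_system (o : option nat) : set (set input_env) :=
  if o is Some i
  then preimage_set_system setT (fun x : input_env => x (inr i)) measurable
  else preimage_set_system setT (fun (x : input_env) => (fun j => x (inl j)) : env (R := R) nat)
    measurable.

Lemma measurable_input_env :
  @measurable _ input_env = <<s \bigcup_o input_system o >>.
Proof.
apply/seteqP; split.
  apply: smallest_sub; first exact: smallest_sigma_algebra.
  move=> _ [[j|i] _ [B mB <-]]; apply: sub_sigma_algebra.
    exists None => //; exists [set y : env nat | B (y j)]; last by rewrite !setTI.
    by have := @measurable_coord R nat j measurableT B mB; rewrite setTI.
  by exists (Some i) => //; exists B.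
apply: smallest_sub; first exact: sigma_algebra_measurable.
move=> _ [[i|] _ [B mB <-]]; first exact: measurable_coord.
have : measurable_fun setT (fun (x : input_env) => (fun j => x (inl j)) : env (R := R) nat).
  by apply: measurable_env => j; exact: measurable_coord.
exact.
Qed.

Lemma measurable_join_input {d} {T : measurableType d} (p Q : nat -> T -> R) :
  (forall i, measurable_fun setT (p i)) -> (forall i, measurable_fun setT (Q i)) ->
  measurable_fun setT (join_input p Q).
Proof. by move=> mp mQ; apply: measurable_env => -[]. Qed.

Definition fixed_point_map (x : input_env) : \bar R :=
  (\sum_(i <oo) (x (inl i) ^+ 2 * (1 + x (inr i)))%:E)%E.

Lemma measurable_fixed_point_map : measurable_fun setT fixed_point_map.
Proof.
apply: measurable_eseries => i; apply/measurable_EFinP/measurable_funM.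
  by apply: measurable_funX; exact: measurable_coord.
by apply: measurable_funD => //; exact: measurable_coord.
Qed.

(** Independence and the prescribed marginals determine the joint law, so the right-hand side of the
    equation may be studied for one convenient input. *)
Lemma fixed_point_input_law {d0 d d1 d2} {T0 : measurableType d0}
    {T : measurableType d} {T1 : measurableType d1} {T2 : measurableType d2}
    (P0 : probability T0 R) (p : nat -> {RV P0 >-> R})
    (P : probability T R) (Q : {RV P >-> R})
    (P1 : probability T1 R) (p1 Q1 : nat -> {RV P1 >-> R})
    (P2 : probability T2 R) (p2 Q2 : nat -> {RV P2 >-> R}) B :
  fixed_point_input P0 p P Q P1 p1 Q1 -> fixed_point_input P0 p P Q P2 p2 Q2 ->
  measurable B ->
  P1 (join_input p1 Q1 @^-1` B) = P2 (join_input p2 Q2 @^-1` B).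
Proof.
move=> [p1law Q1law ind1] [p2law Q2law ind2] mB.
have ind d' (T' : measurableType d') (P' : probability T' R) (p' Q' : nat -> {RV P' >-> R}) :
  independent P' (fun o : option nat =>
    if o is Some i then preimage_set_system setT (Q' i) measurable else sigma_rv p') ->
  independent P' (fun o => preimage_set_system setT (join_input p' Q') (input_system o)).
  apply: independent_sub => -[i|] _ [_ [A mA <-] <-]; rewrite !setTI.
    by exists A; rewrite ?setTI.
  exact: (sigma_rv_preimage _ _ p').
apply: (@eq_law_independent _ _ _ _ _ _ input_env P1 P2 (join_input p1 Q1)
  (join_input p2 Q2) _ input_system) => //.
- exact: measurable_join_input.
- exact: measurable_join_input.
- exact: measurable_input_env.
- by case=> [i|]; apply: setI_closed_preimage => ? ? ? ?; exact: measurableI.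
- exact: ind.
- exact: ind.
- move=> [i|] _ [A mA <-]; rewrite !setTI.
    by rewrite -[LHS]/(P1 (Q1 i @^-1` A)) Q1law// -(Q2law i).
  by rewrite -[LHS]/(P1 [set t | A (p1^~ t)]) p1law// -p2law.
Qed.

End inputs.

Section limit.
Context {R : realType} {d0 d} {T0 : measurableType d0} {T : measurableType d}.
Context {P0 : probability T0 R} {p : nat -> {RV P0 >-> R}}.
Context {P : probability T R} {V : node -> nat -> {RV P >-> R}}.
Context {C : nat -> node -> {RV P >-> nat}}.
Hypothesis V_iid : iid_copies P0 p P V.
Variable a : R.
Hypothesis aE : (\int[P0]_t \sum_(i <oo) (p i t ^+ 2)%:E = a%:E)%E.
Hypothesis a01 : 0 <= a < 1.

Definition limit (t : T) : R := fine (total (tree_env (V := V) t)).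

(** The canonical [Q^(i)]: the same functional applied to the subtree at child [i]. *)
Definition sublimit (i : nat) (t : T) : R :=
  fine (total (subtree i (tree_env (V := V) t))).

Lemma measurable_limit : measurable_fun setT limit.
Proof.
apply: measurableT_comp => //; apply: (measurableT_comp measurable_total).
exact: measurable_tree_env.
Qed.

Lemma measurable_sublimit i : measurable_fun setT (sublimit i).
Proof.
apply: measurableT_comp => //; apply: (measurableT_comp measurable_total).
exact: measurable_subtree_env.
Qed.

HB.instance Definition _ := isMeasurableFun.Build _ _ _ _ limit measurable_limit.
HB.instance Definition _ i :=
  isMeasurableFun.Build _ _ _ _ (sublimit i) (measurable_sublimit i).

Lemma ae_total_fin_num : {ae P, forall t, total (tree_env (V := V) t) \is a fin_num}.
Proof.
apply: ge0_integral_lty_ae => [|t|].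
- by apply: (measurableT_comp measurable_total); exact: measurable_tree_env.
- exact: total_ge0.
- by rewrite (integral_total V_iid a aE a01) ltry.
Qed.

Lemma ae_subtotal_fin_num :
  {ae P, forall t i, total (subtree i (tree_env (V := V) t)) \is a fin_num}.
Proof.
apply: ae_foralln => i.
apply: (ae_same_law P P tree_env (subtree i \o tree_env)
   [set x | total x \is a fin_num] _ _ _ _ ae_total_fin_num).
- exact: measurable_tree_env.
- exact: measurable_subtree_env.
- by move=> B mB; exact: (subtree_law V_iid i).
- rewrite -[X in measurable X]setTI; exact: emeasurable_fin_num measurable_total.
Qed.

Lemma ae_limitE : {ae P, forall t, total (tree_env (V := V) t) = (limit t)%:E}.
Proof. by apply: filterS ae_total_fin_num => t ?; rewrite fineK. Qed.

Lemma expectation_limit : ('E_P[limit] = (a / (1 - a))%:E)%E.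
Proof.
rewrite expectation_def -(integral_total V_iid a aE a01).
apply: ge0_ae_eq_integral => //.
- by apply/measurable_EFinP; exact: measurable_limit.
- by apply: (measurableT_comp measurable_total); exact: measurable_tree_env.
- by move=> t _; rewrite lee_fin fine_ge0// total_ge0.
- by move=> t _; exact: total_ge0.
- by apply: filterS ae_limitE => t -> _.
Qed.

Lemma limit_fixed_point :
  {ae P, forall t, (limit t)%:E = fixed_point_map (join_input (V [::]) sublimit t)}.
Proof.
apply: filterS2 ae_limitE ae_subtotal_fin_num => t <- sfin.
rewrite total_rec; apply: eq_eseriesr => i _ /=.
by rewrite -[X in (1 + X)%E](fineK (sfin i)).
Qed.

Lemma limit_input : fixed_point_input P0 p P limit P (V [::]) sublimit.
Proof.
have [V_law V_ind] := V_iid.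
split => [|i B mB|]; first exact: V_law.
- rewrite -[RHS]/(P (tree_env (V := V) @^-1` [set x | B (fine (total x))])).
  rewrite (subtree_law V_iid i)//.
  have mf : measurable_fun setT (fine \o total (R := R)).
    by apply: measurableT_comp => //; exact: measurable_total.
  by have := mf measurableT B mB; rewrite setTI.
- apply: independent_sub (independent_subtrees V_iid) => -[i|] // _ [B mB <-].
  exists [set x | B (fine (total x))]; last by rewrite !setTI.
  have mf : measurable_fun setT (fine \o total (R := R)).
    by apply: measurableT_comp => //; exact: measurable_total.
  by have := mf measurableT B mB; rewrite setTI.
Qed.

(** By [fixed_point_input_law] the input may be replaced by the root vector and the [sublimit i],
    for which the equation holds almost surely. *)
Lemma limit_law {d'} {T' : measurableType d'} (P' : probability T' R)
    (p' Q' : nat -> {RV P' >-> R}) :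
  fixed_point_input P0 p P limit P' p' Q' ->
  same_law P (fun t => (limit t)%:E) P'
    (fun t => \sum_(i <oo) (p' i t ^+ 2 * (1 + Q' i t))%:E)%E.
Proof.
move=> inp B mB.
have mj : measurable_fun setT (join_input (V [::]) sublimit).
  by apply: measurable_join_input => i //; exact: measurable_sublimit.
have mB' : measurable (fixed_point_map (R := R) @^-1` B).
  by have := measurable_fixed_point_map measurableT B mB; rewrite setTI.
rewrite -[RHS]/(P' (join_input p' Q' @^-1` (fixed_point_map @^-1` B))).
rewrite -(fixed_point_input_law _ _ _ _ _ _ _ _ _ _ _ limit_input inp mB').
apply: ae_eq_measure.
- have mEl : measurable_fun setT (fun t => (limit t)%:E).
    by apply/measurable_EFinP; exact: measurable_limit.
  by have := mEl measurableT B mB; rewrite setTI.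
- by have := mj measurableT _ mB'; rewrite setTI.
- by apply: filterS limit_fixed_point => t /= ->.
Qed.

Hypothesis C_given : choices_given P V C.

Lemma ae_cvg_limit :
  {ae P, forall t, (Y (split_tree (fun k v => C k v t) n))%:R / n%:R ^+ 2
    @[n --> \oo] --> limit t}.
Proof.
have [a0 a1] := andP a01.
(* The midpoint of [a] and 1 serves as the rate [b]. *)
have ab : a < (1 + a) / 2 by lra.
have aeq : {ae P, forall t m, level m (tree_env (V := V) t) = (qlevel (V := V) m t)%:E}.
  by apply: ae_foralln => m; exact: (ae_qlevelE V_iid a aE).
apply: filterS3 ae_limitE aeq (ae_coincidences_rate V_iid C_given a _ aE a0 ab).
move=> t tl tq [r rate].
rewrite (_ : (fun _ => _) = fun n => (\sum_(1 <= m < n.+1)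
    deep_pairs (fun k v => C k v t) m n)%:R / n%:R ^+ 2); last first.
  by apply/funext => n; rewrite Y_split_tree.
apply: (scaled_sum_cvg _ (ray_pairs (fun k v => C k v t)) (qlevel (V := V) ^~ t) _ ((1 + a) / 2) r).
- by apply/andP; split; lra.
- by move=> m; exact: qlevel_ge0.
- by move=> m n n'; exact: ray_pairs_mono.
- exact: rate.
- by move=> m n; exact: deep_pairs_le.
- by move=> m n; exact: ray_pairs_le.
- have cl : (\sum_(1 <= m < k) level m (tree_env (V := V) t))%E @[k --> \oo] -->
      (limit t)%:E.
    by rewrite -tl; apply: is_cvg_nneseries => m _ _; exact: level_ge0.
  have [_] := proj1 (fine_cvgP _ _) cl.
  rewrite (_ : _ \o _ = fun k => \sum_(1 <= m < k) qlevel (V := V) m t)//.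
  apply/funext => k /=; under eq_bigr do rewrite tq.
  by rewrite sumEFin.
Qed.

End limit.

(** * The size-biased variable, and conclusion *)

(** [W] is the sum over [i] of [P_i] times the indicator of [I = i], and given the vector this
    indicator has mean [P_i]. *)
Lemma expectation_size_biased {R : realType} {d0 d1} {T0 : measurableType d0}
    {T1 : measurableType d1} (P0 : probability T0 R) (p : nat -> {RV P0 >-> R})
    (P1 : probability T1 R) (p1 : nat -> {RV P1 >-> R}) (I : {RV P1 >-> nat}) :
  split_vector P0 p -> same_joint_law P1 p1 P0 p -> index_given P1 p1 I ->
  ('E_P1[fun t => p1 (I t) t] = \int[P0]_t \sum_(i <oo) (p i t ^+ 2)%:E)%E.
Proof.
move=> p_split p1law Igiven.
have mp1 : measurable_fun setT (fun t => (fun i => p1 i t) : env (R := R) nat).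
  exact: measurable_env.
have mp0 : measurable_fun setT (fun t => (fun i => p i t) : env (R := R) nat).
  exact: measurable_env.
have p1_ge0 : {ae P1, forall t i, 0 <= p1 i t}.
  apply: (ae_same_law P0 P1 _ _ [set x : env nat | forall i, 0 <= x i] mp0 mp1).
  - by move=> B mB; rewrite -[LHS](p1law B mB).
  - rewrite (_ : [set x : env nat | _] = \bigcap_i [set x | 0 <= x i]); last first.
      by apply/seteqP; split => x h i; [move=> _|]; exact: h.
    apply: bigcap_measurableType => i _.
    have := @measurable_coord R nat i measurableT _ (measurable_itv `[0, +oo[).
    rewrite setTI; congr measurable; apply/seteqP.
    by split => x /=; rewrite in_itv/= andbT.
  - by apply: filterS p_split => t [].
have mI i : measurable (I @^-1` [set i]).
  by rewrite -[X in measurable X]setTI; exact: measurable_funP.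
have mW : measurable_fun setT (fun t => p1 (I t) t).
  move=> _ B mB; rewrite setTI.
  rewrite (_ : _ @^-1` _ = \bigcup_i (I @^-1` [set i] `&` p1 i @^-1` B)).
    apply: bigcupT_measurable => i; apply: measurableI => //.
    by rewrite -[X in measurable X]setTI; exact: measurable_funP.
  by apply/seteqP; split => t /=; [move=> BW; exists (I t)|move=> [i _ [<-]]].
have mind i : measurable_fun setT (\1_(I @^-1` [set i]) : T1 -> R).
  exact: measurable_indic.
rewrite unlock.
(* Absolute values make the terms nonnegative everywhere; the entries themselves are so only almost
   surely. *)
transitivity (\int[P1]_t \sum_(i <oo) (`|p1 i t| * \1_(I @^-1` [set i]) t)%:E)%E.
  rewrite (@ae_eq_integral _ _ _ P1 setT (fun t => (`|p1 (I t) t|)%:E))//.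
  - apply: eq_integral => t _.
    rewrite nneseries_esumT; last by move=> i; rewrite lee_fin mulr_ge0.
    rewrite (esum_single _ _ (I t))//.
    + by rewrite indicE mem_set// mulr1.
    + by move=> j _ jI; rewrite indicE memNset ?mulr0// => /= /esym.
  - exact/measurable_EFinP.
  - by apply/measurable_EFinP; apply: measurableT_comp.
  - by apply: filterS p1_ge0 => t p0 _; rewrite ger0_norm.
have mabs i : measurable_fun setT (fun t => `|p1 i t|) by apply: measurableT_comp.
rewrite integral_nneseries//; last first.
  by move=> i; apply/measurable_EFinP/measurable_funM.
transitivity (\sum_(i <oo) \int[P1]_t (p1 i t ^+ 2)%:E)%E.
  apply: eq_eseriesr => i _.
  transitivity (\int[P1]_t ((`|p1 i t|)%:E * (`|p1 i t|)%:E))%E; last first.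
    by apply: eq_integral => t _; rewrite -EFinM -expr2 real_normK// num_real.
  under eq_integral do rewrite EFinM.
  apply: (ge0_integral_factor P1 _ mp1 _ (fun t => `|p1 i t|)
    (fun x : env nat => (`|x i|)%:E)) => //.
  - move=> B mB; rewrite integral_indic//; last first.
      by rewrite -[X in measurable X]setTI; exact: mp1.
    rewrite setIC [LHS](Igiven i); last exact: (sigma_rv_preimage _ _ p1).
    apply: ae_eq_integral.
    + by rewrite -[X in measurable X]setTI; exact: mp1.
    + by apply: measurable_funTS; exact/measurable_EFinP.
    + by apply: measurable_funTS; exact/measurable_EFinP.
    + by apply: filterS p1_ge0 => t p0 _; rewrite ger0_norm.
  - apply/measurable_EFinP; apply: measurableT_comp => //; exact: measurable_coord.
have msq i : measurable_fun setT (fun t => (p1 i t ^+ 2)%:E).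
  by apply/measurable_EFinP/measurable_funX.
rewrite -integral_nneseries//; last by move=> i t _; rewrite lee_fin sqr_ge0.
apply: (@ge0_integral_eq_law _ _ _ _ _ _ (env nat) P1 P0 (fun t i => p1 i t)
  (fun t i => p i t) (fun y : env nat => \sum_(i <oo) (y i ^+ 2)%:E)%E) => //.
- apply: measurable_eseries => i; apply/measurable_EFinP/measurable_funX.
  exact: measurable_coord.
- by move=> y; apply: nneseries_ge0 => i _ _; rewrite lee_fin sqr_ge0.
Qed.

Theorem theorem5p1 (R : realType)
    (d0 : measure_display) (T0 : measurableType d0) (P0 : probability T0 R)
    (p : nat -> {RV P0 >-> R})
    (d : measure_display) (T : measurableType d) (P : probability T R)
    (V : node -> nat -> {RV P >-> R}) (C : nat -> node -> {RV P >-> nat})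
    (p_split : split_vector P0 p)
    (p_nontrivial : (0 < P0 [set t | exists i, (0 < p i t < 1)%R])%E)
    (V_iid : iid_copies P0 p P V)
    (C_given : choices_given P V C) :
  exists Q : {RV P >-> R},
    [/\ {ae P, forall t,
          (Y (split_tree (fun k v => C k v t) n))%:R / n%:R ^+ 2
            @[n --> \oo] --> Q t},
        {ae P, forall t, (Q t)%:E = Q_series (fun v i => V v i : T -> R) t},
        ('E_P[Q] = (1 - \int[P0]_t \sum_(i <oo) (p i t ^+ 2)%:E)^-1 - 1 /\
         'E_P[Q] < +oo)%E,
        (exists (d' : measure_display) (T' : measurableType d')
           (P' : probability T' R) (p' Q' : nat -> {RV P' >-> R}),
           fixed_point_input P0 p P Q P' p' Q') /\
        (forall (d' : measure_display) (T' : measurableType d')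
           (P' : probability T' R) (p' Q' : nat -> {RV P' >-> R}),
           fixed_point_input P0 p P Q P' p' Q' ->
           same_law P (fun t => (Q t)%:E) P'
             (fun t => \sum_(i <oo) (p' i t ^+ 2 * (1 + Q' i t))%:E)%E) &
        forall (d1 : measure_display) (T1 : measurableType d1)
          (P1 : probability T1 R) (p1 : nat -> {RV P1 >-> R})
          (I : {RV P1 >-> nat}),
          same_joint_law P1 p1 P0 p -> index_given P1 p1 I ->
          (let W := fun t => p1 (I t) t in
           'E_P[Q] = 'E_P1[W] / (1 - 'E_P1[W]))%E].
Proof.
have /andP[S0 S1] := second_moment_lt1 p_split p_nontrivial.
have Sfin : (\int[P0]_t \sum_(i <oo) (p i t ^+ 2)%:E)%E \is a fin_num.
  by rewrite ge0_fin_numE//; exact: lt_trans S1 (ltry _).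
pose a := fine (\int[P0]_t \sum_(i <oo) (p i t ^+ 2)%:E)%E.
have aE : (\int[P0]_t \sum_(i <oo) (p i t ^+ 2)%:E = a%:E)%E by rewrite fineK.
have a01 : 0 <= a < 1 by rewrite -!lee_fin -lte_fin -aE S0 S1.
have a1 : 1 - a != 0 by rewrite subr_eq0 gt_eqF//; case/andP: a01.
exists (limit (V := V)); split.
- exact: (ae_cvg_limit V_iid a aE a01 C_given).
- by apply: filterS (ae_limitE V_iid a aE a01) => t <-; rewrite Q_series_total.
- rewrite (expectation_limit V_iid a aE a01) aE -EFinD inver (negbTE a1) -EFinB ltry.
  (* The two forms of the mean agree: [a / (1 - a)] equals [1 / (1 - a) - 1]. *)
  by split => //; congr EFin; field.
- split; first by exists d, T, P, (V [::]), (sublimit (V := V)); exact: limit_input.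
  by move=> d' T' P' p' Q'; exact: (limit_law V_iid a aE a01).
- move=> d1 T1 P1 p1 I p1law Igiven W.
  rewrite (expectation_limit V_iid a aE a01) (expectation_size_biased P0 p)// aE.
  by rewrite -EFinB inver (negbTE a1).
Qed.
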